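(* Let $A$ be a ring and $\mathfrak a=(t)\subseteq A$ a principal ideal. Let $\phi\colon B\to\bar B$ and $\psi\colon C\to\bar C$ be surjective $A$-homomorphisms of $A$-algebras such that $B$ and $\bar B$ are finitely generated over $A$ and the pairs $(C,\mathfrak aC)$ and $(\bar C,\mathfrak a\bar C)$ are henselian, and let $I$ be the kernel of $\psi$. Let $n,r,h,c$ be natural numbers such that: (1) $\mathfrak a^rC\cap\mathrm{Ann}_C(t)=0$ and $\mathfrak a^r\bar C\cap\mathrm{Ann}_{\bar C}(t)=0$; (2) $\mathfrak a^kC\cap I=\mathfrak a^{k-c}(\mathfrak a^cC\cap I)$ for all $k\geqslant c$; (3) $\mathfrak a^hB\subseteq H_{B/A}$ and $\mathfrak a^h\bar B\subseteq H_{\bar B/A}$; (4) $n>\max(r+2h,\,c+2h,\,4h)$. Let $\alpha_n\colon B\to C/\mathfrak a^nC$ and $\beta_n\colon\bar B\to\bar C/\mathfrak a^n\bar C$ be $A$-homomorphisms with $\psi_n\circ\alpha_n=\beta_n\circ\phi$, where $\psi_n\colon C/\mathfrak a^nC\to\bar C/\mathfrak a^n\bar C$ is induced by $\psi$. Then there exist $A$-homomorphisms $\alpha\colon B\to C$ and $\beta\colon\bar B\to\bar C$ such that $\psi\circ\alpha=\beta\circ\phi$, the composite of $\alpha$ with $C\to C/\mathfrak a^{n-2h}C$ equals the composite of $\alpha_n$ with $C/\mathfrak a^nC\to C/\mathfrak a^{n-2h}C$, and the composite of $\beta$ with $\bar C\to\bar C/\mathfrak a^{n-2h}\bar C$ equals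 the composite of $\beta_n$ with $\bar C/\mathfrak a^n\bar C\to\bar C/\mathfrak a^{n-2h}\bar C$.
   Context: All rings are commutative, unital and Noetherian (this applies to all the algebras named in the statement). For a ring $R$ with an ideal $\mathfrak b$, an étale homomorphism $R\to S$ is called strictly étale if it induces an isomorphism $R/\mathfrak b\to S/\mathfrak bS$; the pair $(R,\mathfrak b)$ is henselian if for every strictly étale homomorphism $\nu\colon R\to S$ there is a homomorphism $\mu\colon S\to R$ with $\mu\circ\nu=\mathrm{Id}_R$. For an $A$-algebra $B$ and a $B$-module $N$, an extension of $B$ by $N$ is an exact sequence $0\to N\to D\to B\to 0$ where $D$ is an $A$-algebra, $D\to B$ is a homomorphism of $A$-algebras, and its kernel $N$ is a square-zero ideal whose induced $B$-module structure is the given one. $\mathrm E_A(B,N)$ denotes the set of isomorphism classes of such extensions (isomorphisms of $A$-algebras inducing the identity on $N$ and $B$); it is a $B$-module under Baer sum, with $b\in B$ acting by pushout along multiplication by $b$ on $N$. Put $H_{B/A}=\bigcap_{N}\mathrm{Ann}_B(\mathrm E_A(B,N))$, the intersection over all $B$-modules $N$. *)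

(* Defs.v *)
From HB Require Import structures.
From mathcomp Require Import all_boot all_order all_algebra.
From mathcomp Require Import all_classical.

Set Implicit Arguments.
Unset Strict Implicit.
Unset Printing Implicit Defensive.

Import GRing.Theory.

Local Open Scope quotient_scope.
Local Open Scope classical_set_scope.
Local Open Scope ring_scope.

(* The zero ring is a legitimate ring (for instance C/J when J = C), so rings
   are [comPzRingType]s.  MathComp's ideals ([idealr]) are proper and its
   quotient rings and algebras are nontrivial, hence the versions below. *)

Definition is_ideal (R : comPzRingType) (I : set R) : Prop :=
  [/\ I 0, forall x y, I x -> I y -> I (x + y) & forall a x, I x -> I (a * x)].

Record ideal (R : comPzRingType) := Ideal {
  ideal_set :> set R;
  idealP : is_ideal ideal_set }.

Lemma is_ideal_gen (R : comPzRingType) (S : set R) :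
  is_ideal (smallest (@is_ideal R) S).
Proof.
split=> [I [[]]|x y Sx Sy I [II SI]|a x Sx I [II SI]] //.
- by case: (II) => _ + _; apply; [apply: Sx|apply: Sy].
- by case: (II) => _ _; apply; apply: Sx.
Qed.

Definition ideal_gen (R : comPzRingType) (S : set R) : ideal R :=
  Ideal (is_ideal_gen S).

Lemma is_ideal_cap (R : comPzRingType) (I J : ideal R) : is_ideal (I `&` J).
Proof.
case: I J => I [I0 ID IM] [J [J0 JD JM]]; split=> //=.
- by move=> x y [? ?] [? ?]; split; [apply: ID|apply: JD].
- by move=> a x [? ?]; split; [apply: IM|apply: JM].
Qed.

Definition ideal_cap (R : comPzRingType) (I J : ideal R) : ideal R :=
  Ideal (is_ideal_cap I J).

Definition ideal_mul (R : comPzRingType) (I J : ideal R) : ideal R :=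
  ideal_gen [set x * y | x in I & y in J].

Definition ideal_exp (R : comPzRingType) (I : ideal R) (k : nat) : ideal R :=
  iter k (ideal_mul I) (ideal_gen setT).

Lemma is_ideal_ker (R S : comPzRingType) (f : {rmorphism R -> S}) :
  is_ideal [set x | f x = 0].
Proof.
split=> [|x y /= fx fy|a x /= fx] /=; first exact: rmorph0.
- by rewrite rmorphD fx fy addr0.
- by rewrite rmorphM fx mulr0.
Qed.

Definition ideal_ker (R S : comPzRingType) (f : {rmorphism R -> S}) : ideal R :=
  Ideal (is_ideal_ker f).

Definition noetherian (R : comPzRingType) : Prop :=
  forall I : ideal R, exists s : seq R, I = ideal_gen [set` s] :> set R.

Section QuotientRing.
Variables (R : comPzRingType) (I : ideal R).

Definition ideal_mem : pred R := fun x => `[< ideal_set I x >].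

Lemma ideal_mem_zmod_closed : zmod_closed ideal_mem.
Proof.
have [I0 ID IM] := idealP I.
split=> [|x y]; rewrite !unfold_in; first exact/asboolP.
move=> /asboolP Ix /asboolP Iy; apply/asboolP; apply: ID => //.
by rewrite -mulN1r; apply: IM.
Qed.

HB.instance Definition _ :=
  GRing.isZmodClosed.Build R ideal_mem ideal_mem_zmod_closed.

Definition ring_quot := Quotient.quot (GRing.ZmodClosed.clone R ideal_mem _).

HB.instance Definition _ := GRing.Zmodule.on ring_quot.

Definition quot_pi (x : R) : ring_quot := \pi x.

Lemma quot_pi_eq x y : quot_pi x = quot_pi y <-> ideal_set I (x - y).
Proof.
rewrite /quot_pi; split=> [/eqP|Ixy].
  by rewrite -Quotient.idealrBE unfold_in => /asboolP.
by apply/eqP; rewrite -Quotient.idealrBE unfold_in; apply/asboolP.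
Qed.

Lemma quot_pi_repr (u : ring_quot) : quot_pi (repr u) = u.
Proof. exact: reprK. Qed.

Lemma quot_pi_sub : zmod_morphism quot_pi.
Proof. by move=> x y; rewrite /quot_pi !piE. Qed.

HB.instance Definition _ :=
  GRing.isZmodMorphism.Build R ring_quot quot_pi quot_pi_sub.

Definition quot_one : ring_quot := quot_pi 1.
Definition quot_mul (u v : ring_quot) : ring_quot := quot_pi (repr u * repr v).

Lemma quot_piM x y : quot_mul (quot_pi x) (quot_pi y) = quot_pi (x * y).
Proof.
have [_ ID IM] := idealP I; apply/quot_pi_eq.
have /quot_pi_eq Ix := quot_pi_repr (quot_pi x).
have /quot_pi_eq Iy := quot_pi_repr (quot_pi y).
set x' := repr _ in Ix *; set y' := repr _ in Iy *.
have -> : x' * y' - x * y = y' * (x' - x) + x * (y' - y).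
  by rewrite !mulrBr [y' * x']mulrC [y' * x]mulrC addrA addrNK.
by apply: ID; apply: IM.
Qed.

Lemma quot_mulA : associative quot_mul.
Proof.
move=> u v w; rewrite -[u]quot_pi_repr -[v]quot_pi_repr -[w]quot_pi_repr.
by rewrite !quot_piM mulrA.
Qed.

Lemma quot_mulC : commutative quot_mul.
Proof. by move=> u v; rewrite /quot_mul mulrC. Qed.

Lemma quot_mul1 : left_id quot_one quot_mul.
Proof. by move=> u; rewrite -[u]quot_pi_repr quot_piM mul1r. Qed.

Lemma quot_mulDl : left_distributive quot_mul +%R.
Proof.
move=> u v w; rewrite -[u]quot_pi_repr -[v]quot_pi_repr -[w]quot_pi_repr.
by rewrite -raddfD !quot_piM -raddfD mulrDl.
Qed.

HB.instance Definition _ :=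
  GRing.Zmodule_isComPzRing.Build ring_quot quot_mulA quot_mulC quot_mul1 quot_mulDl.

Lemma quot_pi_monoid : monoid_morphism quot_pi.
Proof. by split=> // x y; rewrite -quot_piM. Qed.

HB.instance Definition _ :=
  GRing.isMonoidMorphism.Build R ring_quot quot_pi quot_pi_monoid.

End QuotientRing.

(* The map R/I -> S/J induced by f; it is meaningful when f maps I into J,
   see [quot_mapE]. *)
Definition quot_map (R S : comPzRingType) (f : R -> S) (I : ideal R)
  (J : ideal S) : ring_quot I -> ring_quot J := fun u => quot_pi J (f (repr u)).

Lemma quot_mapE (R S : comPzRingType) (f : {rmorphism R -> S}) (I : ideal R)
    (J : ideal S) (x : R) :
  (forall y, ideal_set I y -> ideal_set J (f y)) -> quot_map f J (quot_pi I x) = quot_pi J (f x).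
Proof.
move=> fIJ; apply/quot_pi_eq; rewrite -rmorphB; apply: fIJ.
exact/quot_pi_eq/quot_pi_repr.
Qed.

Record algebra (A : comPzRingType) := Algebra {
  alg_ring :> comPzRingType;
  alg_map : {rmorphism A -> alg_ring} }.

Record alg_hom (A : comPzRingType) (B C : algebra A) := AlgHom {
  alg_hom_map :> {rmorphism B -> C};
  alg_homP : forall a, alg_hom_map (alg_map B a) = alg_map C a }.

Definition quot_alg (A : comPzRingType) (C : algebra A) (J : ideal C) :
  algebra A := @Algebra A (ring_quot J) (quot_pi J \o alg_map C).

Definition ideal_ext (A : comPzRingType) (C : algebra A) (J : ideal A) :
  ideal C := ideal_gen [set alg_map C x | x in J].

Definition is_subring (R : comPzRingType) (S : set R) : Prop :=
  [/\ S 1, forall x y, S x -> S y -> S (x - y)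
    & forall x y, S x -> S y -> S (x * y)].

Definition finitely_generated (A : comPzRingType) (B : algebra A) : Prop :=
  exists s : seq B,
    smallest (@is_subring B) (range (alg_map B) `|` [set` s]) = setT.

Definition formally_etale (R : comPzRingType) (S : algebra R) : Prop :=
  forall (T T' : comPzRingType) (p : {rmorphism T -> T'}),
    (forall y, exists x, p x = y) ->
    (forall x y, p x = 0 -> p y = 0 -> x * y = 0) ->
  forall (u : {rmorphism R -> T}) (v : {rmorphism S -> T'}),
    (forall x, p (u x) = v (alg_map S x)) ->
  exists w : {rmorphism S -> T},
    [/\ forall x, w (alg_map S x) = u x, forall s, p (w s) = v s
      & forall w' : {rmorphism S -> T},
          (forall x, w' (alg_map S x) = u x) -> (forall s, p (w' s) = v s) ->
          w' =1 w].

(* For Noetherian R, the only case used, finite type is the same as finite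
   presentation. *)
Definition etale (R : comPzRingType) (S : algebra R) : Prop :=
  finitely_generated S /\ formally_etale S.

Definition strictly_etale (R : comPzRingType) (b : ideal R) (S : algebra R) :
    Prop :=
  etale S /\ bijective (@quot_map _ _ (alg_map S) b (ideal_ext S b)).

Definition henselian (R : comPzRingType) (b : ideal R) : Prop :=
  forall S : algebra R, strictly_etale b S ->
  exists mu : {rmorphism S -> R}, forall x, mu (alg_map S x) = x.

Record extension (A : comPzRingType) (B : algebra A) (N : lmodType B) :=
  Extension {
    ext_alg : algebra A;
    ext_proj : alg_hom ext_alg B;
    ext_inj : {additive N -> ext_alg};
    ext_inj_inj : injective ext_inj;
    ext_proj_surj : forall b, exists d, ext_proj d = b;
    ext_exact : forall d, ext_proj d = 0 <-> exists x, d = ext_inj x;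
    ext_square0 : forall x y, ext_inj x * ext_inj y = 0;
    ext_action : forall d x, d * ext_inj x = ext_inj (ext_proj d *: x) }.

Definition ext_iso (A : comPzRingType) (B : algebra A) (N : lmodType B)
    (D E : extension N) : Prop :=
  exists f : alg_hom (ext_alg D) (ext_alg E),
    [/\ bijective f, forall x, f (ext_inj D x) = ext_inj E x
      & forall d, ext_proj E (f d) = ext_proj D d].

(* The ring D (+) N with N of square zero, where the B-module N is seen as a
   D-module through p : D -> B. *)
Definition sqzero (D B : comPzRingType) (p : {rmorphism D -> B})
  (N : lmodType B) : Type := (D * N)%type.

Section SquareZero.
Variables (D B : comPzRingType) (p : {rmorphism D -> B}) (N : lmodType B).
Local Notation T := (sqzero p N).

HB.instance Definition _ := GRing.Zmodule.copy T (D * N)%type.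

Definition sqzero_one : T := (1, 0).
Definition sqzero_mul (u v : T) : T :=
  (u.1 * v.1, p u.1 *: v.2 + p v.1 *: u.2).

Lemma sqzero_mulA : associative sqzero_mul.
Proof.
move=> [d x] [e y] [f z]; rewrite /sqzero_mul /= mulrA !rmorphM; congr pair.
rewrite !scalerDr !scalerA addrA; congr (_ + _ + _ *: _).
- by rewrite (mulrC (p f)).
- by rewrite mulrC.
Qed.

Lemma sqzero_mulC : commutative sqzero_mul.
Proof. by move=> u v; rewrite /sqzero_mul mulrC addrC. Qed.

Lemma sqzero_mul1 : left_id sqzero_one sqzero_mul.
Proof.
by move=> [d x]; rewrite /sqzero_mul /= mul1r rmorph1 scale1r scaler0 addr0.
Qed.

Lemma sqzero_mulDl : left_distributive sqzero_mul +%R.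
Proof.
move=> [d x] [e y] [f z]; rewrite /sqzero_mul /=; congr pair => /=.
  by rewrite mulrDl.
by rewrite rmorphD scalerDl scalerDr addrACA.
Qed.

HB.instance Definition _ := GRing.Zmodule_isComPzRing.Build T
  sqzero_mulA sqzero_mulC sqzero_mul1 sqzero_mulDl.

Definition sqzero_inl (d : D) : T := (d, 0).
Definition sqzero_inr (x : N) : T := (0, x).
Definition sqzero_fst (u : T) : D := u.1.

Lemma sqzero_inl_sub : zmod_morphism sqzero_inl.
Proof. by move=> d e; congr pair; rewrite subr0. Qed.

Lemma sqzero_inl_monoid : monoid_morphism sqzero_inl.
Proof. by split=> // d e; congr pair; rewrite /= !scaler0 addr0. Qed.

HB.instance Definition _ :=
  GRing.isZmodMorphism.Build D T sqzero_inl sqzero_inl_sub.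
HB.instance Definition _ :=
  GRing.isMonoidMorphism.Build D T sqzero_inl sqzero_inl_monoid.

Lemma sqzero_inr_sub : zmod_morphism sqzero_inr.
Proof. by move=> x y; congr pair; rewrite subr0. Qed.

HB.instance Definition _ :=
  GRing.isZmodMorphism.Build N T sqzero_inr sqzero_inr_sub.

Lemma sqzero_fst_sub : zmod_morphism sqzero_fst.
Proof. by []. Qed.

Lemma sqzero_fst_monoid : monoid_morphism sqzero_fst.
Proof. by []. Qed.

HB.instance Definition _ :=
  GRing.isZmodMorphism.Build T D sqzero_fst sqzero_fst_sub.
HB.instance Definition _ :=
  GRing.isMonoidMorphism.Build T D sqzero_fst sqzero_fst_monoid.

End SquareZero.

Section TrivialExtension.
Variables (A : comPzRingType) (B : algebra A) (N : lmodType B).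

Definition triv_alg : algebra A :=
  @Algebra A (sqzero idfun N) (@sqzero_inl B B idfun N \o alg_map B).

Definition triv_proj : alg_hom triv_alg B :=
  @AlgHom A triv_alg B (@sqzero_fst B B idfun N) (fun=> erefl).

Definition triv_inj : {additive N -> triv_alg} := @sqzero_inr B B idfun N.

Lemma triv_inj_inj : injective triv_inj.
Proof. by move=> x y []. Qed.

Lemma triv_proj_surj b : exists d, triv_proj d = b.
Proof. by exists (@sqzero_inl B B idfun N b). Qed.

Lemma triv_exact d : triv_proj d = 0 <-> exists x, d = triv_inj x.
Proof.
split=> [|[x ->] //]; case: d => b x /= b0.
by exists x; congr pair.
Qed.

Lemma triv_square0 x y : triv_inj x * triv_inj y = 0.
Proof. by congr pair => /=; rewrite ?mulr0 // !scale0r addr0. Qed.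

Lemma triv_action d x : d * triv_inj x = triv_inj (triv_proj d *: x).
Proof. by congr pair => /=; rewrite ?mulr0 // scale0r addr0. Qed.

(* Its class is the zero of E_A(B,N) for the Baer sum. *)
Definition triv_ext : extension N :=
  Extension triv_inj_inj triv_proj_surj triv_exact triv_square0 triv_action.

End TrivialExtension.

Section Pushout.
Variables (A : comPzRingType) (B : algebra A) (N M : lmodType B).
Variables (f : {linear N -> M}) (D : extension N).
Let p : {rmorphism ext_alg D -> B} := ext_proj D.
Local Notation T := (sqzero p M).

Lemma ext_proj_inj x : p (ext_inj D x) = 0.
Proof. by apply/ext_exact; exists x. Qed.

Lemma is_ideal_antidiag :
  is_ideal (range (fun x => (ext_inj D x, - f x) : T)).
Proof.
split=> [|_ _ [x _ <-] [y _ <-]|[d y] _ [x _ <-]].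
- exists 0 => //; congr pair; first exact: raddf0.
  by rewrite /= [f 0]raddf0 oppr0.
- exists (x + y) => //; congr pair; first exact: raddfD.
  by rewrite /= [f _]raddfD opprD.
- exists (p d *: x) => //; congr pair => /=; first by rewrite -ext_action.
  by rewrite ext_proj_inj scale0r addr0 linearZ scalerN.
Qed.

Definition antidiag : ideal T := Ideal is_ideal_antidiag.

Definition push_alg : algebra A :=
  @Algebra A (ring_quot antidiag)
    (@quot_pi T antidiag \o (@sqzero_inl _ _ p M \o alg_map (ext_alg D))).

Definition push_proj_fun (u : push_alg) : B := p (repr u).1.

Lemma push_projE (u : T) : push_proj_fun (quot_pi antidiag u) = p u.1.
Proof.
rewrite /push_proj_fun; have /quot_pi_eq := quot_pi_repr (quot_pi antidiag u).
case=> x _ /(congr1 fst) /= /(congr1 p); rewrite ext_proj_inj => /esym/eqP.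
by rewrite rmorphB subr_eq0 => /eqP.
Qed.

Lemma push_proj_sub : zmod_morphism push_proj_fun.
Proof.
move=> u v; rewrite -[u]quot_pi_repr -[v]quot_pi_repr -rmorphB !push_projE.
by rewrite -rmorphB.
Qed.

Lemma push_proj_monoid : monoid_morphism push_proj_fun.
Proof.
split=> [|u v]; first by rewrite push_projE rmorph1.
rewrite -[u]quot_pi_repr -[v]quot_pi_repr -rmorphM !push_projE.
by rewrite -rmorphM.
Qed.

HB.instance Definition _ :=
  GRing.isZmodMorphism.Build push_alg B push_proj_fun push_proj_sub.
HB.instance Definition _ :=
  GRing.isMonoidMorphism.Build push_alg B push_proj_fun push_proj_monoid.

Lemma push_proj_alg a : push_proj_fun (alg_map push_alg a) = alg_map B a.
Proof. by rewrite push_projE; apply: alg_homP. Qed.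

Definition push_proj : alg_hom push_alg B :=
  @AlgHom A push_alg B push_proj_fun push_proj_alg.

Definition push_inj : {additive M -> push_alg} :=
  @quot_pi T antidiag \o @sqzero_inr _ _ p M.

Lemma push_inj_inj : injective push_inj.
Proof.
move=> x y /quot_pi_eq [z _ [+ fz]].
rewrite subr0 -[RHS](raddf0 (ext_inj D)) => /ext_inj_inj z0; move: fz.
by rewrite z0 raddf0 oppr0 => /esym/eqP; rewrite subr_eq0 => /eqP.
Qed.

Lemma push_proj_surj b : exists d, push_proj d = b.
Proof.
have [d <-] := ext_proj_surj D b.
by exists (quot_pi antidiag (d, 0)); apply: push_projE.
Qed.

Lemma push_exact d : push_proj d = 0 <-> exists x, d = push_inj x.
Proof.
rewrite -[d]quot_pi_repr; case: (repr d) => e y /=; rewrite push_projE /=.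
split=> [/ext_exact[x ->]|[x /quot_pi_eq[z _ [+ _]]]].
  exists (y + f x); apply/quot_pi_eq; exists x => //.
  by congr pair => /=; rewrite ?subr0 // opprD addrA subrr add0r.
by rewrite subr0 => <-; apply: ext_proj_inj.
Qed.

Lemma push_square0 x y : push_inj x * push_inj y = 0.
Proof.
rewrite -[LHS]rmorphM -(rmorph0 (quot_pi antidiag)); congr (quot_pi _ _).
by congr pair => /=; rewrite ?mulr0 // raddf0 !scale0r addr0.
Qed.

Lemma push_action d x : d * push_inj x = push_inj (push_proj d *: x).
Proof.
rewrite -[d]quot_pi_repr /= push_projE -[LHS]rmorphM; congr (quot_pi _ _).
by congr pair => /=; rewrite ?mulr0 // raddf0 scale0r addr0.
Qed.

(* (D (+) M) / {(x, - f x) | x in N} *)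
Definition pushout : extension M :=
  Extension push_inj_inj push_proj_surj push_exact push_square0 push_action.

End Pushout.

(* H_{B/A}: with E_A(B,N) the B-module of isomorphism classes of extensions of
   B by N, an element b annihilates E_A(B,N) iff for each extension D the
   pushout of D along b : N -> N, which represents b * [D], is isomorphic to
   the trivial extension.  Neither N nor D is assumed to be Noetherian. *)
Definition H_alg (A : comPzRingType) (B : algebra A) : set B :=
  [set b | forall (N : lmodType B) (D : extension N),
    ext_iso (pushout ( *:%R b) D) (triv_ext N)].

Arguments H_alg {A} B _.

(* Main.v *)
Require Import Defs.
From HB Require Import structures.
From mathcomp Require Import all_boot all_order all_algebra.
From mathcomp Require Import all_classical.
From mathcomp Require Import ring zify.

Set Implicit Arguments.
Unset Strict Implicit.
Unset Printing Implicit Defensive.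

Import GRing.Theory.

Local Open Scope classical_set_scope.
Local Open Scope ring_scope.

(* Choose generators g of B over A, let P be the polynomial ring on them and
   K = ker (P -> B). That t^h kills E_A(B, K/K^2) means that some derivation
   P -> K/K^2 over A is t^h on K/K^2; it is given by polynomials s_j in K. They
   serve as a Newton iteration: given x0 with K(x0) in t^m C, the square system
   s(x) = k (D_y s(x) - t^h y), with k = t^(m - h) and x = x0 + k y, becomes
   after division by t^m a system y + g + t q(y) = 0, which is solvable because
   it defines a strictly etale algebra. At its solution the ideal F generated by
   K(x) satisfies t^h F <= k F, and t-torsion-freeness of t^r C together with
   Nakayama's lemma gives F = 0, so x defines a homomorphism B -> C. If K(x0)
   lies in an ideal, such as ker psi, modulo which t^(m - h) is
   t-torsion-free, then x and x0 are congruent modulo this ideal.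
   One applies this to B' -> C' first, losing t^h, and then to B -> C with a
   starting point x0 lifting both beta phi and alpha_n modulo t^(n - h), losing
   another t^h. *)

(** * Terms and presented algebras *)

(** Polynomial expressions. Negation needs no constructor, being multiplication by the constant -1;
    distinct terms may denote the same polynomial, and only their values matter. *)
Inductive term (R V : Type) : Type :=
  | Cst of R
  | Var of V
  | Add of term R V & term R V
  | Mul of term R V & term R V.

Arguments Cst {R V}.
Arguments Var {R V}.

Section Evaluation.
Variables (R V : Type) (T : comPzRingType).
Implicit Types (u : R -> T) (x w : V -> T) (s : term R V).

Fixpoint eval u x s : T :=
  match s with
  | Cst a => u a
  | Var j => x j
  | Add s1 s2 => eval u x s1 + eval u x s2
  | Mul s1 s2 => eval u x s1 * eval u x s2
  end.

(** The directional derivative at [x] along [w], with the coefficients treated as constants. *)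
Fixpoint deval u x w s : T :=
  match s with
  | Cst _ => 0
  | Var j => w j
  | Add s1 s2 => deval u x w s1 + deval u x w s2
  | Mul s1 s2 => eval u x s1 * deval u x w s2 + eval u x s2 * deval u x w s1
  end.

Lemma eq_eval u u' x x' s : u =1 u' -> x =1 x' -> eval u x s = eval u' x' s.
Proof. by move=> eu ex; elim: s => //= s1 -> s2 ->. Qed.

Lemma eq_deval u u' x x' w w' s : u =1 u' -> x =1 x' -> w =1 w' ->
  deval u x w s = deval u' x' w' s.
Proof.
move=> eu ex ew; elim: s => //= s1 -> s2 -> //.
by rewrite !(eq_eval _ eu ex).
Qed.

Lemma devalD u x w w' s :
  deval u x (fun j => w j + w' j) s = deval u x w s + deval u x w' s.
Proof.
by elim: s => [a|j|s1 E1 s2 E2|s1 E1 s2 E2] //=; rewrite ?E1 ?E2; ring.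
Qed.

Lemma devalZ u x w c s :
  deval u x (fun j => c * w j) s = c * deval u x w s.
Proof.
by elim: s => [a|j|s1 E1 s2 E2|s1 E1 s2 E2] //=; rewrite ?E1 ?E2; ring.
Qed.

Lemma eval_taylor u x w s : (forall j k, w j * w k = 0) ->
  eval u (fun j => x j + w j) s = eval u x s + deval u x w s.
Proof.
(* Each derivative is a linear combination of the [w j], so a product of two of them vanishes; it is
   the only second-order contribution of a product of terms. *)
move=> ww; have dd s1 s2 : deval u x w s1 * deval u x w s2 = 0.
  have wd j : w j * deval u x w s2 = 0.
    elim: s2 => [a|k|r IHr r' IHr'|r IHr r' IHr'] //=; first exact: mulr0.
      by rewrite mulrDr IHr IHr' addr0.
    by rewrite mulrDr !(mulrCA (w j)) IHr IHr' !mulr0 addr0.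
  elim: s1 => [a|k|r IHr r' IHr'|r IHr r' IHr'] //=; first exact: mul0r.
    by rewrite mulrDl IHr IHr' addr0.
  by rewrite mulrDl -!mulrA IHr IHr' !mulr0 addr0.
elim: s => [a|j|s1 E1 s2 E2|s1 E1 s2 E2] //=; rewrite ?E1 ?E2 ?addr0 //.
  by ring.
by rewrite mulrDl !mulrDr dd addr0 addrA (mulrC (deval _ _ _ s1)).
Qed.

End Evaluation.

Section EvalMorph.
Variables (R V : Type) (T T' : comPzRingType) (p : {rmorphism T -> T'}).

Lemma rmorph_eval (u : R -> T) (x : V -> T) s :
  p (eval u x s) = eval (p \o u) (p \o x) s.
Proof. by elim: s => //= s1 <- s2 <-; rewrite ?rmorphD ?rmorphM. Qed.

Lemma rmorph_deval (u : R -> T) (x w : V -> T) s :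
  p (deval u x w s) = deval (p \o u) (p \o x) (p \o w) s.
Proof.
by elim: s => [a|j|s1 E1 s2 E2|s1 E1 s2 E2] //=;
  rewrite ?rmorph0 ?rmorphD ?rmorphM ?rmorph_eval ?E1 ?E2.
Qed.

End EvalMorph.

Section Presentation.
Variables (R : comPzRingType) (V : Type) (eqs : set (term R V)).

Definition sat (T : comPzRingType) (u : R -> T) (x : V -> T) : Prop :=
  forall s, eqs s -> eval u x s = 0.

(** Quantifying over all solutions in all [R]-algebras makes the ring axioms of the quotient
    immediate, since each of them holds in every model. *)
Definition model_eq (s1 s2 : term R V) : Prop :=
  forall (T : comPzRingType) (u : {rmorphism R -> T}) (x : V -> T),
    sat u x -> eval u x s1 = eval u x s2.

HB.instance Definition _ := gen_eqMixin (term R V).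
HB.instance Definition _ := gen_choiceMixin (term R V).

Definition model_eqb : rel (term R V) := fun s1 s2 => `[< model_eq s1 s2 >].

Lemma model_eqb_equiv : equiv_class_of model_eqb.
Proof.
split=> [s|s1 s2|s1 s2 s3]; first exact/asboolP.
  by apply/asboolP/asboolP => H T u x ux; rewrite H.
by move=> /asboolP H1 /asboolP H2; apply/asboolP => T u x ux; rewrite H1 ?H2.
Qed.

Canonical model_eqb_equivRel := EquivRelPack model_eqb_equiv.

Local Open Scope quotient_scope.

(* The universal R-algebra on generators V subject to the relations s = 0, for
   s in eqs: terms up to equality in all models. Unlike {poly R}, it makes
   sense over the zero ring. *)
Definition pres : Type := {eq_quot model_eqb_equivRel}.

HB.instance Definition _ := Choice.on pres.

Definition cls (s : term R V) : pres := \pi_{eq_quot model_eqb_equivRel} s.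
Definition rep (x : pres) : term R V := repr x.

Lemma cls_rep x : cls (rep x) = x.
Proof. exact: reprK. Qed.

Lemma cls_eq s1 s2 : cls s1 = cls s2 <-> model_eq s1 s2.
Proof.
split=> [/eqmodP/asboolP //|H].
by apply/eqmodP/asboolP.
Qed.

Lemma rep_cls s : model_eq (rep (cls s)) s.
Proof. exact/cls_eq/cls_rep. Qed.

Definition pres_add x y := cls (Add (rep x) (rep y)).
Definition pres_mul x y := cls (Mul (rep x) (rep y)).
Definition pres_opp x := cls (Mul (Cst (- 1)) (rep x)).

Lemma pres_addA : associative pres_add.
Proof.
by move=> x y z; apply/cls_eq => T u v uv /=; rewrite !rep_cls //= addrA.
Qed.

Lemma pres_addC : commutative pres_add.
Proof. by move=> x y; apply/cls_eq => T u v uv /=; rewrite addrC. Qed.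

Lemma pres_add0 : left_id (cls (Cst 0)) pres_add.
Proof.
move=> x; rewrite -[RHS]cls_rep; apply/cls_eq => T u v uv /=.
by rewrite rep_cls //= rmorph0 add0r.
Qed.

Lemma pres_addN : left_inverse (cls (Cst 0)) pres_opp pres_add.
Proof.
move=> x; apply/cls_eq => T u v uv /=.
by rewrite rep_cls //= rmorphN1 mulN1r addNr rmorph0.
Qed.

HB.instance Definition _ :=
  GRing.isZmodule.Build pres pres_addA pres_addC pres_add0 pres_addN.

Lemma pres_mulA : associative pres_mul.
Proof.
by move=> x y z; apply/cls_eq => T u v uv /=; rewrite !rep_cls //= mulrA.
Qed.

Lemma pres_mulC : commutative pres_mul.
Proof. by move=> x y; apply/cls_eq => T u v uv /=; rewrite mulrC. Qed.

Lemma pres_mul1 : left_id (cls (Cst 1)) pres_mul.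
Proof.
move=> x; rewrite -[RHS]cls_rep; apply/cls_eq => T u v uv /=.
by rewrite rep_cls //= rmorph1 mul1r.
Qed.

Lemma pres_mulDl : left_distributive pres_mul +%R.
Proof.
by move=> x y z; apply/cls_eq => T u v uv /=; rewrite !rep_cls //= mulrDl.
Qed.

HB.instance Definition _ := GRing.Zmodule_isComPzRing.Build pres
  pres_mulA pres_mulC pres_mul1 pres_mulDl.

Lemma clsD s1 s2 : cls (Add s1 s2) = cls s1 + cls s2.
Proof. by apply/cls_eq => T u v uv /=; rewrite !rep_cls. Qed.

Lemma clsM s1 s2 : cls (Mul s1 s2) = cls s1 * cls s2.
Proof. by apply/cls_eq => T u v uv /=; rewrite !rep_cls. Qed.

Definition pres_cst (a : R) : pres := cls (Cst a).

Lemma pres_cst_sub : zmod_morphism pres_cst.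
Proof.
move=> a b; apply/cls_eq => T u v uv /=.
by rewrite !rep_cls //= rep_cls //= rmorphB rmorphN1 mulN1r.
Qed.

Lemma pres_cst_monoid : monoid_morphism pres_cst.
Proof.
split=> // a b; apply/cls_eq => T u v uv /=.
by rewrite !rep_cls //= rmorphM.
Qed.

HB.instance Definition _ :=
  GRing.isZmodMorphism.Build R pres pres_cst pres_cst_sub.
HB.instance Definition _ :=
  GRing.isMonoidMorphism.Build R pres pres_cst pres_cst_monoid.

Definition pres_alg : algebra R := @Algebra R pres pres_cst.

Definition pres_var (j : V) : pres := cls (Var j).

Lemma eval_pres s : eval pres_cst pres_var s = cls s.
Proof. by elim: s => //= s1 -> s2 ->; rewrite ?clsD ?clsM. Qed.

Lemma pres_sat : sat pres_cst pres_var.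
Proof.
move=> s rs; rewrite eval_pres; apply/cls_eq => T u v uv /=.
by rewrite uv // rmorph0.
Qed.

Section Universal.
Variables (T : comPzRingType) (u : {rmorphism R -> T}) (x : V -> T).
Hypothesis ux : sat u x.

Definition pres_lift_fun (z : pres) : T := eval u x (rep z).

Lemma pres_lift_sub : zmod_morphism pres_lift_fun.
Proof.
move=> y z; rewrite /pres_lift_fun rep_cls //= rep_cls //=.
by rewrite rmorphN1 mulN1r.
Qed.

Lemma pres_lift_monoid : monoid_morphism pres_lift_fun.
Proof.
split=> [|y z]; first by rewrite /pres_lift_fun rep_cls //= rmorph1.
by rewrite /pres_lift_fun rep_cls.
Qed.

HB.instance Definition _ :=
  GRing.isZmodMorphism.Build pres T pres_lift_fun pres_lift_sub.
HB.instance Definition _ :=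
  GRing.isMonoidMorphism.Build pres T pres_lift_fun pres_lift_monoid.

Lemma pres_lift : exists w : {rmorphism pres_alg -> T},
  forall s, w (cls s) = eval u x s.
Proof. by exists pres_lift_fun => s; apply: rep_cls. Qed.

End Universal.

Lemma pres_ext (T : comPzRingType) (w w' : {rmorphism pres_alg -> T}) :
  (forall a, w (pres_cst a) = w' (pres_cst a)) ->
  (forall j, w (pres_var j) = w' (pres_var j)) -> w =1 w'.
Proof.
move=> ea ev z; rewrite -[z]cls_rep -eval_pres !rmorph_eval.
exact: eq_eval.
Qed.

End Presentation.

(** * Extensions and derivations *)

Section KernelExtension.
Variables (A : comPzRingType) (B D : algebra A) (p : alg_hom D B).
Hypothesis p_surj : forall b, exists d, p d = b.
Hypothesis p_sq0 : forall d e, p d = 0 -> p e = 0 -> d * e = 0.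

Definition in_ker : pred D := fun d => p d == 0.

Lemma in_ker_zmod : zmod_closed in_ker.
Proof.
split=> [|d e]; rewrite !unfold_in /in_ker; first by rewrite rmorph0.
by move=> /eqP pd /eqP pe; rewrite rmorphB pd pe subrr.
Qed.

HB.instance Definition _ := GRing.isZmodClosed.Build D in_ker in_ker_zmod.

Record ker_mod := KerMod { ker_val :> D; ker_valP : in_ker ker_val }.

HB.instance Definition _ := [isSub for ker_val].
HB.instance Definition _ := [Choice of ker_mod by <:].
HB.instance Definition _ := [SubChoice_isSubZmodule of ker_mod by <:].

Lemma ker_valD (x y : ker_mod) : ker_val x + ker_val y = ker_val (x + y).
Proof. by []. Qed.

Lemma ker_val0 (x : ker_mod) : p (ker_val x) = 0.
Proof. exact/eqP/ker_valP. Qed.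

Definition surj_lift (b : B) : D := projT1 (cid (p_surj b)).

Lemma surj_liftK b : p (surj_lift b) = b.
Proof. exact: (projT2 (cid (p_surj b))). Qed.

(** The kernel has square zero, so [D] acts on it through [B]. Hence scaling by the chosen lift
    [surj_lift b] does not depend on the choice. *)
Lemma mul_ker_eq d e (x : ker_mod) :
  p d = p e -> d * ker_val x = e * ker_val x.
Proof.
move=> pde; apply/eqP; rewrite -subr_eq0 -mulrBl; apply/eqP/p_sq0.
  by rewrite rmorphB pde subrr.
exact: ker_val0.
Qed.

Lemma ker_scale_subproof b (x : ker_mod) : in_ker (surj_lift b * ker_val x).
Proof. by rewrite /in_ker rmorphM ker_val0 mulr0. Qed.

Definition ker_scale b (x : ker_mod) : ker_mod :=
  KerMod (ker_scale_subproof b x).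

Lemma ker_scaleE d x : ker_val (ker_scale (p d) x) = d * ker_val x.
Proof. by rewrite /=; apply: mul_ker_eq; rewrite surj_liftK. Qed.

Lemma ker_scaleA a b x : ker_scale a (ker_scale b x) = ker_scale (a * b) x.
Proof.
apply: val_inj; rewrite /= mulrA; apply: mul_ker_eq.
by rewrite rmorphM !surj_liftK.
Qed.

Lemma ker_scale1 : left_id 1 ker_scale.
Proof.
by move=> x; apply: val_inj; rewrite -(rmorph1 p) [LHS]ker_scaleE mul1r.
Qed.

Lemma ker_scaleDr : right_distributive ker_scale +%R.
Proof. by move=> b x y; apply: val_inj; rewrite /= mulrDr. Qed.

Lemma ker_scaleDl x : {morph ker_scale^~ x : a b / a + b}.
Proof.
move=> a b; apply: val_inj; rewrite /= -mulrDl; apply: mul_ker_eq.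
by rewrite rmorphD !surj_liftK.
Qed.

HB.instance Definition _ := GRing.Zmodule_isLmodule.Build B ker_mod
  ker_scaleA ker_scale1 ker_scaleDr ker_scaleDl.

Lemma ker_exact d : p d = 0 <-> exists x : ker_mod, d = ker_val x.
Proof.
split=> [/eqP pd|[x ->]]; last exact: ker_val0.
by exists (KerMod pd).
Qed.

Lemma ker_action d (x : ker_mod) : d * ker_val x = ker_val (p d *: x).
Proof. by rewrite -ker_scaleE. Qed.

Definition ker_ext : extension ker_mod :=
  @Extension A B ker_mod D p (val : {additive ker_mod -> D}) val_inj p_surj
    ker_exact (fun x y => p_sq0 (ker_val0 x) (ker_val0 y)) ker_action.

(* An isomorphism from the pushout along b to the trivial extension restricts
   to a derivation of D into the kernel, which is b on the kernel. *)
Lemma H_alg_derivation (b : D) : H_alg B (p b) ->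
  exists dlt : D -> D,
    [/\ forall d, p (dlt d) = 0, forall a, dlt (alg_map D a) = 0,
        {morph dlt : d e / d + e},
        forall d e, dlt (d * e) = d * dlt e + e * dlt d
      & forall d, p d = 0 -> dlt d = b * d].
Proof.
move=> /(_ _ ker_ext) [F [_ F_inj F_proj]].
(* The canonical map to the pushout. The composite of [q] and [F] is a ring homomorphism to the
   trivial extension with first component [p], so its second component is a derivation. *)
pose q (d : D) : push_alg ( *:%R (p b)) ker_ext :=
  quot_pi (antidiag ( *:%R (p b)) ker_ext) (d, 0).
have F1 d : (F (q d)).1 = p d.
  by have := F_proj (q d); rewrite /= push_projE.
exists (fun d => ker_val (F (q d)).2); split.
- by move=> d; apply: ker_val0.
- move=> a; have /= := alg_homP F a.
  by rewrite -/(q _) => ->.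
- move=> d e; rewrite ker_valD; congr (ker_val _).
  have -> : q (d + e) = q d + q e.
    by rewrite /q -rmorphD; congr (quot_pi _ _); congr pair; rewrite addr0.
  by rewrite rmorphD.
- move=> d e; rewrite !ker_action ker_valD; congr (ker_val _).
  have -> : q (d * e) = q d * q e.
    rewrite /q -rmorphM; congr (quot_pi _ _); congr pair.
    by rewrite /= !scaler0 addr0.
  by rewrite rmorphM /= !F1.
- move=> d /ker_exact[x ->]; rewrite ker_action; congr (ker_val _).
  (* In the pushout [(x, 0)] and [(0, p b *: x)] agree, as they differ by an element of the
     antidiagonal. *)
  have -> : q (ker_val x) = push_inj ( *:%R (p b)) ker_ext (p b *: x).
    apply/quot_pi_eq; exists x => //; congr pair; rewrite /= ?subr0 //.
    by rewrite sub0r.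
  by have := F_inj (p b *: x) => /= ->.
Qed.

End KernelExtension.

Lemma generated_by_terms (A : comPzRingType) (B : algebra A) :
  finitely_generated B -> exists (n : nat) (g : 'I_n -> B),
    forall b, exists s : term A 'I_n, eval (alg_map B) g s = b.
Proof.
case=> l gen; exists (size l), (fun i => tnth (in_tuple l) i) => b.
have : [set: B] b by [].
rewrite -gen => /(_ [set b | exists s, eval (alg_map B) _ s = b]); apply.
split; last first.
  move=> y [[a _ <-]|/(nthP 0)[i il <-]]; first by exists (Cst a).
  exists (Var (Ordinal il)) => /=.
  by rewrite (tnth_nth 0).
split=> [|_ _ [s1 <-] [s2 <-]|_ _ [s1 <-] [s2 <-]].
- by exists (Cst 1); rewrite /= rmorph1.
- exists (Add s1 (Mul (Cst (- 1)) s2)).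
  by rewrite /= rmorphN1 mulN1r.
- by exists (Mul s1 s2).
Qed.

Section Witness.
Variables (A : comPzRingType) (B : algebra A) (V : Type) (g : V -> B).
Hypothesis g_gen : forall b, exists s, eval (alg_map B) g s = b.

Definition vanishing : set (term A V) := [set s | eval (alg_map B) g s = 0].

(* For the polynomial ring P on V and K = ker (P -> B), the derivation of P/K^2
   into K/K^2 that is b on K/K^2 sends the variable j to the class of s j. *)
Lemma H_alg_witness (b : A) : H_alg B (alg_map B b) ->
  exists s : V -> term A V, (forall j, vanishing (s j)) /\
  forall (T : comPzRingType) (u : {rmorphism A -> T}) (x : V -> T),
    (forall f f', vanishing f -> vanishing f' ->
      eval u x f * eval u x f' = 0) ->
    forall f, vanishing f ->
      deval u x (fun j => eval u x (s j)) f = u b * eval u x f.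
Proof.
move=> Hb; pose eqs : set (term A V) :=
  [set s | exists f f', [/\ vanishing f, vanishing f' & s = Mul f f']].
have [|p pE] := @pres_lift A V eqs B (alg_map B) g.
  by move=> _ [f [f' [f0 _ ->]]] /=; rewrite f0 mul0r.
have pA a : p (alg_map (pres_alg eqs) a) = alg_map B a by rewrite pE.
pose P : alg_hom (pres_alg eqs) B := AlgHom pA.
have P_surj y : exists d, P d = y.
  by have [s <-] := g_gen y; exists (cls eqs s); rewrite [LHS]pE.
have P_sq0 d e : P d = 0 -> P e = 0 -> d * e = 0.
  rewrite -[d]cls_rep -[e]cls_rep => Pd Pe.
  rewrite -[LHS]clsM -eval_pres; apply: pres_sat.
  by exists (rep d), (rep e); split=> //; rewrite /vanishing /= -pE.
have [|dlt [dltP dltA dltD dltM dltK]] :=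
  @H_alg_derivation A B _ P P_surj P_sq0 (alg_map (pres_alg eqs) b).
  by rewrite alg_homP.
exists (fun j => rep (dlt (pres_var eqs j))); split=> [j|T u x sq0 f f0].
  by rewrite /vanishing /= -pE cls_rep.
(* By [sq0] the point [x] factors through P/K^2, so the identity [dltK] can be carried to [T] along
   [w]. *)
have [|w wE] := @pres_lift A V eqs T u x.
  by move=> _ [f1 [f2 [f10 f20 ->]]] /=; apply: sq0.
have dlt_eval s : dlt (cls eqs s) = deval (@pres_cst A V eqs) (pres_var eqs)
    (fun j => dlt (pres_var eqs j)) s.
  elim: s => [a|j|s1 E1 s2 E2|s1 E1 s2 E2] //=; first exact: dltA.
    by rewrite clsD dltD E1 E2.
  by rewrite clsM dltM E1 E2 !eval_pres.
have := dltK (cls eqs f); rewrite dlt_eval [P _]pE => /(_ f0) /(congr1 w).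
have wu : w \o @pres_cst A V eqs =1 u by move=> a; apply: wE.
have wx : w \o pres_var eqs =1 x by move=> j; apply: wE.
rewrite rmorph_deval rmorphM wE [w _]wE /= => <-.
by apply/esym/eq_deval => //= j; rewrite -wE cls_rep.
Qed.

End Witness.

(** * Square systems over henselian pairs *)

Section Substitution.
Variables (R R' : comPzRingType) (V V' : Type) (f : R -> R').
Variables (sigma tau : V -> term R' V').

Fixpoint subst (s : term R V) : term R' V' :=
  match s with
  | Cst a => Cst (f a)
  | Var j => sigma j
  | Add s1 s2 => Add (subst s1) (subst s2)
  | Mul s1 s2 => Mul (subst s1) (subst s2)
  end.

(** [deval] as a term, at the point [sigma] and along [tau]: derivatives can then occur in equations
    whose unknowns are in the point or the direction. *)
Fixpoint tderiv (s : term R V) : term R' V' :=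
  match s with
  | Cst _ => Cst 0
  | Var j => tau j
  | Add s1 s2 => Add (tderiv s1) (tderiv s2)
  | Mul s1 s2 => Add (Mul (subst s1) (tderiv s2)) (Mul (subst s2) (tderiv s1))
  end.

Variables (T : comPzRingType) (u : {rmorphism R' -> T}) (y : V' -> T).

Lemma eval_subst s :
  eval u y (subst s) = eval (u \o f) (fun j => eval u y (sigma j)) s.
Proof. by elim: s => //= s1 -> s2 ->. Qed.

Lemma eval_tderiv s :
  eval u y (tderiv s) =
  deval (u \o f) (fun j => eval u y (sigma j)) (fun j => eval u y (tau j)) s.
Proof.
by elim: s => [a|j|s1 E1 s2 E2|s1 E1 s2 E2] //=;
  rewrite ?rmorph0 ?E1 ?E2 ?eval_subst.
Qed.

End Substitution.

(** The coefficients are the partial derivatives, that is, the derivatives along the unit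
    vectors. *)
Lemma deval_basis (R : Type) (n : nat) (T : comPzRingType) (u : R -> T)
    (x w : 'I_n -> T) s :
  deval u x w s = \sum_k deval u x (fun j => (j == k)%:R) s * w k.
Proof.
elim: s => [a|j|s1 E1 s2 E2|s1 E1 s2 E2] //=.
- by rewrite big1 // => k _; rewrite mul0r.
- rewrite (bigD1 j) //= eqxx mul1r big1 ?addr0 // => k /negPf kj.
  by rewrite eq_sym kj mul0r.
- by rewrite E1 E2 -big_split /=; apply: eq_bigr => k _; rewrite mulrDl.
- rewrite E1 E2 !mulr_sumr -big_split /=; apply: eq_bigr => k _.
  by rewrite mulrDl !mulrA.
Qed.

Lemma mulmx_sq0 (T T' : comPzRingType) (p : {rmorphism T -> T'}) m n k
    (M : 'M[T]_(m, n)) (N : 'M[T]_(n, k)) :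
  (forall x y, p x = 0 -> p y = 0 -> x * y = 0) ->
  map_mx p M = 0 -> map_mx p N = 0 -> M *m N = 0.
Proof.
move=> sq0 pM pN; apply/matrixP => i j; rewrite !mxE big1 // => l _.
apply: sq0; first by have /matrixP/(_ i l) := pM; rewrite !mxE.
by have /matrixP/(_ l j) := pN; rewrite !mxE.
Qed.

Section SquareSystem.
Variables (C : comPzRingType) (t : C) (n : nat).
Variables (q : 'I_n -> term C 'I_n) (g : 'I_n -> C).

Section System.
Variables (T : comPzRingType) (u : {rmorphism C -> T}) (y : 'cV[T]_n).
Let y' j := y j 0.

Definition sys : 'cV[T]_n :=
  \col_j (u (g j) + y j 0 + u t * eval u y' (q j)).

(** The factor [t] in front of [q] makes this matrix the identity modulo [t]. *)
Definition jac : 'M[T]_n :=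
  \matrix_(j, k) ((j == k)%:R + u t * deval u y' (fun i => (i == k)%:R) (q j)).

Lemma jac_mul m (w : 'M_(n, m)) j k : (jac *m w) j k =
  w j k + u t * deval u y' (fun i => w i k) (q j).
Proof.
rewrite mxE deval_basis mulr_sumr.
under eq_bigr do rewrite mxE mulrDl.
rewrite big_split /=; congr (_ + _).
  rewrite (bigD1 j) //= eqxx mul1r big1 ?addr0 // => i /negPf ij.
  by rewrite eq_sym ij mul0r.
by apply: eq_bigr => i _; rewrite mulrA.
Qed.

Lemma sys_taylor (w : 'cV[T]_n) : (forall j k, w j 0 * w k 0 = 0) ->
  \col_j (u (g j) + (y + w) j 0 +
          u t * eval u (fun j => (y + w) j 0) (q j)) = sys + jac *m w.
Proof.
move=> ww; apply/colP => j; rewrite [RHS]mxE jac_mul !mxE.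
have -> : eval u (fun j => (y + w) j 0) (q j) =
          eval u y' (q j) + deval u y' (fun j => w j 0) (q j).
  rewrite -eval_taylor //; apply: eq_eval => // i.
  by rewrite mxE.
by ring.
Qed.

End System.

Lemma map_sys (T T' : comPzRingType) (u : {rmorphism C -> T})
    (u' : {rmorphism C -> T'}) (p : {rmorphism T -> T'}) y :
  p \o u =1 u' -> map_mx p (sys u y) = sys u' (map_mx p y).
Proof.
move=> pu; apply/colP => j; rewrite !mxE !rmorphD rmorphM /= -!pu.
rewrite rmorph_eval; congr (_ + _ * _).
by apply: eq_eval => // i; rewrite /= mxE.
Qed.

Lemma map_jac (T T' : comPzRingType) (u : {rmorphism C -> T})
    (u' : {rmorphism C -> T'}) (p : {rmorphism T -> T'}) y :
  p \o u =1 u' -> map_mx p (jac u y) = jac u' (map_mx p y).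
Proof.
move=> pu; apply/matrixP => j k.
rewrite !mxE rmorphD rmorphM rmorph_nat /= -!pu rmorph_deval.
congr (_ + _ * _); apply: eq_deval => // i /=; first by rewrite mxE.
by rewrite rmorph_nat.
Qed.

Section SquareZeroLift.
Variables (T T' : comPzRingType) (p : {rmorphism T -> T'}).
Hypothesis p_sq0 : forall x y, p x = 0 -> p y = 0 -> x * y = 0.
Variables (u : {rmorphism C -> T}) (u' : {rmorphism C -> T'}).
Hypothesis pu : p \o u =1 u'.

Lemma sys_lift y' W' : (forall z, exists x, p x = z) ->
  sys u' y' = 0 -> jac u' y' *m W' = 1%:M ->
  exists y W, [/\ map_mx p y = y', map_mx p W = W', sys u y = 0
    & jac u y *m W = 1%:M].
Proof.
move=> p_surj y'0 jW'; pose lft z := projT1 (cid (p_surj z)).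
have lftK z : p (lft z) = z by exact: (projT2 (cid (p_surj z))).
pose y0 := map_mx lft y'; pose W0 := map_mx lft W'.
have py0 : map_mx p y0 = y' by apply/matrixP => i j; rewrite !mxE lftK.
have pW0 : map_mx p W0 = W' by apply/matrixP => i j; rewrite !mxE lftK.
have psys : map_mx p (sys u y0) = 0 by rewrite (map_sys _ pu) py0.
(* One Newton step. It is exact because [W0] inverts the Jacobian matrix modulo the kernel of [p]
   and that kernel has square zero. *)
pose w : 'cV[T]_n := - (W0 *m sys u y0).
have pw : map_mx p w = 0 by rewrite map_mxN map_mxM psys mulmx0 oppr0.
have ww j k : w j 0 * w k 0 = 0.
  apply: p_sq0; first by have /colP/(_ j) := pw; rewrite !mxE.
  by have /colP/(_ k) := pw; rewrite !mxE.
have jE y : map_mx p y = y' -> map_mx p (jac u y *m W0 - 1%:M) = 0.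
  by move=> py; rewrite map_mxB map_mxM (map_jac _ pu) py pW0 jW' map_mx1 subrr.
have py : map_mx p (y0 + w) = y' by rewrite map_mxD pw addr0.
(* The error of [W0] as an inverse at the new point. Since [E *m E = 0], the product of 1 + E and 1
   - E is 1, which gives the corrected inverse. *)
pose E : 'M[T]_n := jac u (y0 + w) *m W0 - 1%:M.
have EE : E *m E = 0 by exact: (mulmx_sq0 p_sq0 (jE _ py) (jE _ py)).
exists (y0 + w), (W0 *m (1%:M - E)); split=> //.
- by rewrite map_mxM map_mxB map_mx1 jE // subr0 mulmx1.
- have -> : sys u (y0 + w) = sys u y0 + jac u y0 *m w by rewrite -sys_taylor.
  rewrite mulmxN mulmxA -[X in X - _]mul1mx -mulmxBl -opprB mulNmx.
  by rewrite (mulmx_sq0 p_sq0) ?oppr0 // jE.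
- have -> : jac u (y0 + w) *m (W0 *m (1%:M - E)) = (1%:M + E) *m (1%:M - E).
    by rewrite mulmxA; congr (_ *m _); rewrite [RHS]addrC subrK.
  by rewrite mulmxBr mulmx1 mulmxDl mul1mx EE addr0 addrK.
Qed.

(** By Taylor's formula the invertible Jacobian matrix kills the difference of the two solutions, so
    they agree; then so do the inverse matrices. *)
Lemma sys_lift_uniq y W y1 W1 :
  sys u y = 0 -> jac u y *m W = 1%:M -> sys u y1 = 0 -> jac u y1 *m W1 = 1%:M ->
  map_mx p y = map_mx p y1 -> y1 = y /\ W1 = W.
Proof.
move=> y0 jW y10 jW1 pyy1; pose w : 'cV[T]_n := y1 - y.
have y1E : y1 = y + w by rewrite addrC subrK.
have pw : map_mx p w = 0 by rewrite map_mxB pyy1 subrr.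
have ww j k : w j 0 * w k 0 = 0.
  apply: p_sq0; first by have /colP/(_ j) := pw; rewrite !mxE.
  by have /colP/(_ k) := pw; rewrite !mxE.
have jw : jac u y *m w = 0.
  by have := sys_taylor u y ww; rewrite y0 add0r => <-; rewrite -y1E.
have w0 : w = 0 by rewrite -[w]mul1mx -(mulmx1C jW) -mulmxA jw mulmx0.
have yy : y1 = y by rewrite y1E w0 addr0.
split=> //; rewrite yy in jW1.
by rewrite -[W1]mul1mx -(mulmx1C jW) -mulmxA jW1 mulmx1.
Qed.

End SquareZeroLift.

(* Besides the unknowns y there are n^2 unknowns for the inverse of the
   Jacobian matrix. *)
Let V : Type := ('I_n + 'I_n * 'I_n)%type.

(** The second family says that the Jacobian matrix times the unknown matrix is the identity: by
    [jac_mul], entry (j, k) of this product involves the derivative of [q j] along column k. *)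
Definition etale_eqs : set (term C V) :=
  [set s | (exists j, s = Add (Add (Cst (g j)) (Var (inl j)))
             (Mul (Cst t) (subst idfun (fun i => Var (inl i)) (q j)))) \/
           (exists j k, s = Add (Cst (- (j == k)%:R)) (Add (Var (inr (j, k)))
             (Mul (Cst t) (tderiv idfun (fun i => Var (inl i))
               (fun i => Var (inr (i, k))) (q j)))))].

Definition col_of (T : Type) (v : V -> T) : 'cV[T]_n := \col_j v (inl j).
Definition mat_of (T : Type) (v : V -> T) : 'M[T]_n :=
  \matrix_(j, k) v (inr (j, k)).

Lemma sat_etale (T : comPzRingType) (u : {rmorphism C -> T}) (v : V -> T) :
  sat etale_eqs u v <->
  sys u (col_of v) = 0 /\ jac u (col_of v) *m mat_of v = 1%:M.
Proof.
have E1 j : eval u v (subst idfun (fun i => Var (inl i)) (q j)) =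
    eval u (fun j => col_of v j 0) (q j).
  by rewrite eval_subst; apply: eq_eval => // i; rewrite mxE.
have E2 j k : eval u v (tderiv idfun (fun i => Var (inl i))
    (fun i => Var (inr (i, k))) (q j)) =
    deval u (fun j => col_of v j 0) (fun i => mat_of v i k) (q j).
  by rewrite eval_tderiv; apply: eq_deval => // i; rewrite mxE.
split=> [sv|[s0 j1] _ [[j ->]|[j [k ->]]]].
- split.
    apply/colP => j; rewrite !mxE -E1.
    exact: (sv _ (or_introl (ex_intro _ j erefl))).
  apply/matrixP => j k; rewrite jac_mul !mxE -E2; apply/eqP.
  rewrite -subr_eq0 addrC -(rmorph_nat u) -rmorphN; apply/eqP.
  exact: (sv _ (or_intror (ex_intro _ j (ex_intro _ k erefl)))).
- by rewrite /= E1; have /colP/(_ j) := s0; rewrite !mxE.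
- rewrite /= E2; have /matrixP/(_ j k) := j1; rewrite jac_mul !mxE => ->.
  by rewrite rmorphN rmorph_nat addNr.
Qed.

Definition etale_alg : algebra C := pres_alg etale_eqs.

Lemma etale_sys : let v := pres_var etale_eqs in
  sys (alg_map etale_alg) (col_of v) = 0 /\
  jac (alg_map etale_alg) (col_of v) *m mat_of v = 1%:M.
Proof. by apply/sat_etale; apply: pres_sat. Qed.

Lemma etale_alg_fg : finitely_generated etale_alg.
Proof.
exists [seq pres_var etale_eqs v | v <- enum {: 'I_n + 'I_n * 'I_n}].
apply/seteqP; split=> // z _ S [[S1 SB SM] Sgen].
have SD x y : S x -> S y -> S (x + y).
  move=> Sx Sy; rewrite -[y]opprK -[- y]add0r -(subrr 1).
  by apply: (SB) => //; apply: (SB) => //; apply: SB.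
rewrite -[z]cls_rep; elim: (rep z) => [a|v|s1 E1 s2 E2|s1 E1 s2 E2].
- by apply: Sgen; left; exists a.
- by apply: Sgen; right; apply/mapP; exists v => //; rewrite mem_enum.
- by rewrite clsD; apply: SD.
- by rewrite clsM; apply: SM.
Qed.

(** Homomorphisms out of [etale_alg] are solutions together with an inverse of the Jacobian matrix,
    so [sys_lift] gives existence and [sys_lift_uniq] uniqueness. *)
Lemma etale_alg_formally : formally_etale etale_alg.
Proof.
move=> T T' p p_surj p_sq0 u v puv.
pose u' : {rmorphism C -> T'} := v \o alg_map etale_alg.
have map_sol (T1 T2 : comPzRingType) (u1 : {rmorphism C -> T1})
    (u2 : {rmorphism C -> T2}) (w : {rmorphism T1 -> T2}) (x : V -> T1) :
    w \o u1 =1 u2 ->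
    sys u1 (col_of x) = 0 /\ jac u1 (col_of x) *m mat_of x = 1%:M ->
    sys u2 (col_of (w \o x)) = 0 /\
    jac u2 (col_of (w \o x)) *m mat_of (w \o x) = 1%:M.
  move=> wu [s0 j1].
  have -> : col_of (w \o x) = map_mx w (col_of x).
    by apply/colP => i; rewrite !mxE.
  have -> : mat_of (w \o x) = map_mx w (mat_of x).
    by apply/matrixP => i j; rewrite !mxE.
  rewrite -(map_sys _ wu) -(map_jac _ wu) s0 -map_mxM j1 map_mx1.
  by split=> //; apply/matrixP => i j; rewrite !mxE rmorph0.
have [s0 j1] := map_sol _ _ _ u' v _ (fun=> erefl) etale_sys.
have [y [W [py pW sy jW]]] := @sys_lift T T' p p_sq0 u u' puv _ _ p_surj s0 j1.
pose x (i : V) : T :=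
  match i with inl j => y j 0 | inr jk => W jk.1 jk.2 end.
have xy : col_of x = y by apply/colP => j; rewrite mxE.
have xW : mat_of x = W by apply/matrixP => j k; rewrite mxE.
have [|w wE] := @pres_lift C V etale_eqs T u x.
  by apply/sat_etale; rewrite xy xW.
exists w; split=> [a|s|w' w'u pw' s]; first exact: wE.
  apply: (@pres_ext _ _ _ _ (p \o w) v) => [a|[j|[j k]]] /=; rewrite [w _]wE.
  - exact: puv.
  - by have /colP/(_ j) := py; rewrite !mxE.
  - by have /matrixP/(_ j k) := pW; rewrite !mxE.
have [s1 j2] := map_sol _ _ _ u w' _ w'u etale_sys.
have [|y1 W1] := @sys_lift_uniq T T' p p_sq0 u y W _ _ sy jW s1 j2.
  apply/colP => j; have /colP/(_ j) := py.
  by rewrite !mxE => ->; rewrite /= pw'.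
apply: pres_ext => [a|[j|[j k]]]; rewrite [w _]wE ?w'u //=.
  by rewrite -y1 mxE.
by rewrite -W1 mxE.
Qed.

(** Modulo [b] the term with [t] disappears and the equations read y = -g and W = 1; their only
    solution lies in C/b itself. *)
Lemma etale_alg_strict (b : ideal C) : ideal_set b t ->
  bijective (quot_map (alg_map etale_alg) (ideal_ext etale_alg b) :
    ring_quot b -> _).
Proof.
move=> bt; set J := ideal_ext etale_alg b; set al := alg_map etale_alg.
have JE y : ideal_set b y -> ideal_set J (al y).
  by move=> bY I [II]; apply; exists y.
pose x (i : V) : ring_quot b :=
  match i with inl j => quot_pi b (- g j) | inr jk => (jk.1 == jk.2)%:R end.
pose pib : {rmorphism C -> ring_quot b} := quot_pi b.
have pt : pib t = 0.
  by rewrite -(rmorph0 (quot_pi b)); apply/quot_pi_eq; rewrite subr0.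
have [|rho rhoE] := @pres_lift C V etale_eqs _ pib x.
  apply/sat_etale; split.
    apply/colP => j; rewrite !mxE pt mul0r addr0 -(rmorphD pib) subrr.
    exact: rmorph0.
  by apply/matrixP => j k; rewrite jac_mul !mxE pt mul0r addr0.
have rho_al c : rho (al c) = quot_pi b c by apply: rhoE.
have [J0 JD JM] := idealP J.
have rhoJ s : ideal_set J s -> rho s = 0.
  move=> /(_ (ideal_ker rho)); apply; split; first exact: is_ideal_ker.
  move=> _ [y bY <-]; rewrite /= rho_al -(rmorph0 (quot_pi b)).
  by apply/quot_pi_eq; rewrite subr0.
(* Every element is congruent modulo [J] to some [al c], and [rho] detects [c] modulo [b]; so [rho]
   induces the inverse map. *)
have lft (s : etale_alg) : exists c,
    rho s = quot_pi b c /\ quot_pi J s = quot_pi J (al c).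
  have [s0 j1] := etale_sys.
  rewrite -[s]cls_rep.
  elim: (rep s) => [a|[j|[j k]]|s1 [c1 [E1 F1]] s2 [c2 [E2 F2]]
    |s1 [c1 [E1 F1]] s2 [c2 [E2 F2]]].
  - by exists a; split=> //; apply: rho_al.
  - exists (- g j); split; first exact: rhoE.
    apply/quot_pi_eq; rewrite rmorphN opprK addrC -/(pres_var _ _).
    have /colP/(_ j) := s0; rewrite !mxE => /eqP; rewrite addr_eq0 => /eqP ->.
    rewrite -mulrN mulrC; apply: JM; exact: JE.
  - exists (j == k)%:R; split; first by rewrite rmorph_nat; apply: rhoE.
    apply/quot_pi_eq; have /matrixP/(_ j k) := j1.
    rewrite jac_mul !mxE rmorph_nat => <-.
    rewrite -/(pres_var _ _) opprD addrA subrr add0r -mulrN mulrC.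
    by apply: JM; apply: JE.
  - by exists (c1 + c2); rewrite clsD !rmorphD /= E1 E2 F1 F2.
  - by exists (c1 * c2); rewrite clsM !rmorphM /= E1 E2 F1 F2.
exists (fun z => rho (repr z)) => z.
  rewrite -[z in LHS]quot_pi_repr quot_mapE //.
  have /quot_pi_eq/rhoJ/eqP := quot_pi_repr (quot_pi J (al (repr z))).
  by rewrite rmorphB subr_eq0 => /eqP ->; rewrite rho_al quot_pi_repr.
have [c [-> E]] := lft (repr z).
by rewrite quot_mapE // -E quot_pi_repr.
Qed.

(** The retraction given by henselianity sends the universal solution in [etale_alg] to a solution
    in [C]. *)
Lemma henselian_sys (b : ideal C) : henselian b -> ideal_set b t ->
  exists y : 'I_n -> C, forall j, g j + y j + t * eval idfun y (q j) = 0.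
Proof.
move=> hens bt.
have [|mu muE] := hens etale_alg.
  by split; [split; [exact: etale_alg_fg|exact: etale_alg_formally]
            |exact: etale_alg_strict].
exists (fun j => mu (pres_var etale_eqs (inl j))) => j.
have [/colP/(_ j) + _] := etale_sys; rewrite !mxE => /(congr1 mu).
rewrite !rmorphD rmorphM rmorph_eval rmorph0 /= !muE => <-.
congr (_ + _ * _); apply: eq_eval => i /=; first by rewrite muE.
by rewrite mxE.
Qed.

End SquareSystem.

(** The inverse solves the one-variable system -1 + y + t c y = 0. *)
Lemma henselian_unit (C : comPzRingType) (t : C) (b : ideal C) :
  henselian b -> ideal_set b t -> forall c, exists d, (1 + t * c) * d = 1.
Proof.
move=> hens bt c.
have [y] := @henselian_sys C t 1
  (fun=> Mul (Cst c) (Var ord0)) (fun=> -1) b hens bt.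
move=> /(_ ord0) /= E; exists (y ord0).
by apply/eqP; rewrite -subr_eq0 -[X in _ == X]E; apply/eqP; ring.
Qed.

(** * The Newton iteration *)

Section Ideals.
Variable C : comPzRingType.
Implicit Types (I J : ideal C) (S : set C).

Lemma gen_mem S x : S x -> ideal_set (ideal_gen S) x.
Proof. by move=> Sx I [_]; apply. Qed.

Lemma gen_min S I x : S `<=` ideal_set I -> ideal_set (ideal_gen S) x ->
  ideal_set I x.
Proof. by move=> SI /(_ _ (conj (idealP I) SI)). Qed.

Lemma ideal0 I : ideal_set I 0.
Proof. by case: (idealP I). Qed.

Lemma idealD I x y : ideal_set I x -> ideal_set I y -> ideal_set I (x + y).
Proof. by case: (idealP I) => _ + _; apply. Qed.

Lemma idealM I a x : ideal_set I x -> ideal_set I (a * x).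
Proof. by case: (idealP I) => _ _; apply. Qed.

Lemma idealN I x : ideal_set I x -> ideal_set I (- x).
Proof. by rewrite -mulN1r; apply: idealM. Qed.

Lemma is_ideal_colon (c : C) I : is_ideal [set z | ideal_set I (c * z)].
Proof.
split=> [|x y /= Ix Iy|a x /= Ix] /=; first by rewrite mulr0; apply: ideal0.
  by rewrite mulrDr; apply: idealD.
by rewrite mulrCA; apply: idealM.
Qed.

Definition ideal_colon (c : C) I : ideal C := Ideal (is_ideal_colon c I).

Lemma is_ideal_scale (c : C) I : is_ideal [set c * z | z in ideal_set I].
Proof.
split=> [|_ _ [x Ix <-] [y Iy <-]|a _ [x Ix <-]].
- by exists 0; rewrite ?mulr0 //; apply: ideal0.
- by exists (x + y); rewrite ?mulrDr //; apply: idealD.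
- by exists (a * x); rewrite 1?mulrCA //; apply: idealM.
Qed.

Definition ideal_scale (c : C) I : ideal C := Ideal (is_ideal_scale c I).

Lemma deval_ideal R V (u : R -> C) (x y : V -> C) s I :
  (forall j, ideal_set I (y j)) -> ideal_set I (deval u x y s).
Proof.
move=> Iy; elim: s => [a|j|s1 E1 s2 E2|s1 E1 s2 E2] //=.
- exact: ideal0.
- exact: idealD.
- by apply: idealD; apply: idealM.
Qed.

(** The derivative is taken at the new point [x], as in the equation s(x) = k (D_y s(x) - t^h y),
    where it will cancel. The remainder is a term in [y], so that it can enter a square system, and
    it has no constant term, whence the statement on ideals. *)
Lemma eval_taylor2 (A : comPzRingType) V (u : {rmorphism A -> C})
    (x0 : V -> C) (k : C) (s : term A V) :
  exists Q : term C V, forall y, let x j := x0 j + k * y j in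
    eval u x s = eval u x0 s + k * deval u x y s + k ^+ 2 * eval idfun y Q /\
    forall I, (forall j, ideal_set I (y j)) -> ideal_set I (eval idfun y Q).
Proof.
pose sigma (j : V) := Add (Cst (x0 j)) (Mul (Cst k) (Var j)).
pose ev := eval u x0; pose dv := tderiv u sigma Var.
elim: s => [a|j|s1 [Q1 E1] s2 [Q2 E2]|s1 [Q1 E1] s2 [Q2 E2]].
- exists (Cst 0) => y x; split=> [|I _] /=; last exact: ideal0.
  by rewrite !mulr0 !addr0.
- exists (Cst 0) => y x; split=> [|I _] /=; last exact: ideal0.
  by rewrite mulr0 addr0.
- exists (Add Q1 Q2) => y x /=.
  have [-> I1] := E1 y; have [-> I2] := E2 y; split=> [|I Iy]; first by ring.
  by apply: idealD; [apply: I1|apply: I2].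
(* The product of the derivatives has the sign -1 because they are taken at [x] and not at [x0]. *)
exists (Add (Add (Mul (Cst (ev s1)) Q2) (Mul (Cst (ev s2)) Q1))
            (Add (Mul (Cst (k ^+ 2)) (Mul Q1 Q2))
                 (Mul (Cst (- 1)) (Mul (dv s1) (dv s2))))) => y x /=.
have dvE s : eval idfun y (dv s) = deval u x y s.
  rewrite (eval_tderiv u sigma Var [the {rmorphism C -> C} of idfun]).
  exact: eq_deval.
have [F1 I1] := E1 y; have [F2 I2] := E2 y.
split=> [|I Iy]; last first.
  have [I1y I2y] := (I1 I Iy, I2 I Iy).
  apply: idealD; first by apply: idealD; apply: idealM.
  apply: idealD; first by apply: idealM; apply: idealM.
  by apply: idealM; apply: idealM; rewrite dvE; apply: deval_ideal.
rewrite !dvE -!/(x _) -/(eval u x s1) -/(eval u x s2).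
move: F1 F2; rewrite -/x -!/(ev _).
move: (ev s1) (ev s2) (eval u x s1) (eval u x s2) (deval u x y s1)
  (deval u x y s2) (eval idfun y Q1) (eval idfun y Q2) => a0 b0 a b a' b' q q'.
by move=> -> ->; ring.
Qed.

(** Generators are eliminated one by one: if a = t (c a + w) modulo [J], then the unit 1 - t c
    brings [a] into the ideal of [J] and the remaining generators. *)
Lemma nakayama (t : C) (J : ideal C) (s : seq C) :
  (forall c, exists d, (1 + t * c) * d = 1) ->
  (forall x, x \in s -> exists2 v,
    ideal_set (ideal_gen (ideal_set J `|` [set` s])) v &
    ideal_set J (x - t * v)) ->
  forall x, x \in s -> ideal_set J x.
Proof.
move=> tu; elim: s => [|a s IHs] // sJ.
pose G (l : seq C) : ideal C := ideal_gen (ideal_set J `|` [set` l]).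
have JG l x : ideal_set J x -> ideal_set (G l) x.
  by move=> Jx; apply: gen_mem; left.
have sG l x : x \in l -> ideal_set (G l) x.
  by move=> lx; apply: gen_mem; right.
have asplit v : ideal_set (G (a :: s)) v ->
    exists c w, ideal_set (G s) w /\ v = c * a + w.
  have HI : is_ideal [set v | exists c w, ideal_set (G s) w /\ v = c * a + w].
    split=> [|_ _ [c [w [Gw ->]]] [c' [w' [Gw' ->]]]|b _ [c [w [Gw ->]]]].
    - by exists 0, 0; rewrite mul0r addr0; split=> //; apply: ideal0.
    - exists (c + c'), (w + w'); split; last by ring.
      exact: idealD.
    - by exists (b * c), (b * w); split; [apply: idealM|ring].
  apply: (@gen_min _ (Ideal HI)) => x [Jx|lx].
    by exists 0, x; split; [apply: JG|rewrite mul0r add0r].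
  have /orP[/eqP ->|sx] : (x == a) || (x \in s) by rewrite -in_cons.
    by exists 1, 0; split; [apply: ideal0|rewrite mul1r addr0].
  by exists 0, x; split; [apply: sG|rewrite mul0r add0r].
have Ga : ideal_set (G s) a.
  have [|v /asplit[c [w [Gw ->]]] Jv] := sJ a; first by rewrite inE eqxx.
  have [d dE] := tu (- c).
  have -> : a = d * (a - t * (c * a + w)) + d * t * w.
    by rewrite -[LHS]mul1r -dE; ring.
  by apply: idealD; apply: idealM => //; apply: JG.
have GG v : ideal_set (G (a :: s)) v -> ideal_set (G s) v.
  apply: gen_min => x [Jx|lx]; first exact: JG.
  have /orP[/eqP -> //|] : (x == a) || (x \in s) by rewrite -in_cons.
  exact: sG.
have sJ' x : x \in s -> ideal_set J x.
  apply: IHs => {}x sx; have [|v /GG Gv Jv] := sJ x; last by exists v.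
  by rewrite inE sx orbT.
have GJ x : ideal_set (G s) x -> ideal_set J x.
  by apply: gen_min => {}x [//|]; apply: sJ'.
by move=> x; rewrite inE => /orP[/eqP ->|]; [apply: GJ|apply: sJ'].
Qed.

End Ideals.

(** * Differentiation by dual numbers *)

Section DualNumbers.
Variables (R : comPzRingType) (A V : Type) (u : A -> R).
Local Notation dual := (sqzero (@idfun R) (R^o : lmodType R)).
Variables (x y : V -> R).
Let X j : dual := (x j, y j).
Let u2 a : dual := (u a, 0).

(** Evaluation at x + eps y, with eps^2 = 0, yields value and derivative; an identity valid over all
    rings can thus be differentiated. *)
Lemma eval_dual s : eval u2 X s = (eval u x s, deval u x y s).
Proof. by elim: s => //= s1 -> s2 ->. Qed.

Lemma deval_dual (w : V -> R) s :
  deval u2 X (fun j => (0, w j) : dual) s = (0, deval u x w s).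
Proof.
elim: s => //= s1 E1 s2 E2; first by rewrite E1 E2; congr pair; exact: addr0.
rewrite E1 E2 !eval_dual; congr pair; rewrite /= ?mulr0 ?addr0 //.
by rewrite !scale0r !addr0.
Qed.

End DualNumbers.

Lemma torsion_exp (C : comPzRingType) (t : C) r :
  (forall z, t * (t ^+ r * z) = 0 -> t ^+ r * z = 0) ->
  forall h z, t ^+ h * (t ^+ r * z) = 0 -> t ^+ r * z = 0.
Proof.
move=> tor; elim=> [|h IHh] z; first by rewrite expr0 mul1r.
rewrite exprSr -mulrA (mulrCA t) => E; apply: tor.
by rewrite mulrCA; apply: IHh.
Qed.

(** * Correcting an approximate point of [B] with values in [C] *)

Section Newton.
Variables (A : comPzRingType) (B C : algebra A) (n : nat) (g : 'I_n -> B).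
Hypothesis g_gen : forall b, exists s, eval (alg_map B) g s = b.
Variables (t0 : A) (h m r : nat) (b : ideal C).
Local Notation t := (alg_map C t0).
Local Notation u := (alg_map C).
Local Notation K := (vanishing g).
Hypothesis HB : H_alg B (alg_map B (t0 ^+ h)).
Hypothesis C_noeth : noetherian C.
Hypothesis C_hens : henselian b.
Hypothesis bt : ideal_set b t.
Hypothesis tor : forall z, t * (t ^+ r * z) = 0 -> t ^+ r * z = 0.
Hypotheses (hm : (2 * h < m)%N) (rm : (r + h <= m)%N).

(* t^h F <= k F + F^2 at the solution, since t^h f = D_s f modulo K^2 and
   D_(D_y s) f = t^h D_y f modulo K for f in K. *)
Lemma newton (x0 : 'I_n -> C) :
  (forall f, K f -> exists z, eval u x0 f = t ^+ m * z) ->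
  exists y : 'I_n -> C,
    (forall f, K f -> eval u (fun j => x0 j + t ^+ (m - h) * y j) f = 0) /\
    forall I : ideal C, (forall f, K f -> ideal_set I (eval u x0 f)) ->
      (forall z, ideal_set I (t ^+ m * z) -> ideal_set I (t ^+ (m - h) * z)) ->
      forall j, ideal_set I (t ^+ (m - h) * y j).
Proof.
move=> x0K; set k := t ^+ (m - h).
have [s [sK sE]] := H_alg_witness g_gen HB.
have /choice[g0 g0E] : forall j, exists z, eval u x0 (s j) = t ^+ m * z.
  by move=> j; apply: x0K; apply: sK.
have /choice[Q QE] := fun j => eval_taylor2 u x0 k (s j).
have tu := henselian_unit C_hens bt.
(* In s(x) = k (D_y s(x) - t^h y) the Taylor expansion cancels the derivative and leaves t^m g0 + k
   t^h y + k^2 Q(y) = 0. Here k t^h = t^m and k^2 = t^m t^(m - 2h); since 2h < m, one factor [t] can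
   be split off after division by t^m, and the predecessor counts the rest. *)
have [y yE] := @henselian_sys C t n
  (fun j => Mul (Cst (t ^+ (m - 2 * h).-1)) (Q j)) g0 b C_hens bt.
pose e := (m - 2 * h).-1.
have kE : k = t ^+ h * (t * t ^+ e).
  by rewrite -exprS -exprD /k /e; congr (_ ^+ _); lia.
have tmE : t ^+ m = t ^+ h * k.
  by rewrite /k -exprD; congr (_ ^+ _); lia.
have krE : k = t ^+ r * t ^+ (m - h - r).
  by rewrite /k -exprD; congr (_ ^+ _); lia.
exists y; pose x j := x0 j + k * y j.
pose w j := deval u x y (s j) - t ^+ h * y j.
have sx j : eval u x (s j) = k * w j.
  have [-> _] := QE j y.
  rewrite -/x g0E /w tmE.
  have -> : g0 j = - y j - t * (t ^+ e * eval idfun y (Q j)).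
    by apply/eqP; rewrite -subr_eq0 -(yE j) /=; apply/eqP; ring.
  have kk : k ^+ 2 = k * (t ^+ h * (t * t ^+ e)) by rewrite -kE.
  by rewrite kk; ring.
pose F : ideal C := ideal_gen [set eval u x f | f in K].
have FK f : K f -> ideal_set F (eval u x f).
  by move=> Kf; apply: gen_mem; exists f.
(* By Taylor's formula f(x) = f(x0) modulo [k], and f(x0) lies in t^m C, hence in k C. It follows
   that F^2 <= k F. *)
have Fk z : ideal_set F z -> exists z', z = k * z'.
  have HI : is_ideal [set z | exists z', z = k * z'].
    split=> [|_ _ [z1 ->] [z2 ->]|c _ [z1 ->]].
    - by exists 0; rewrite mulr0.
    - by exists (z1 + z2); rewrite mulrDr.
    - by exists (c * z1); rewrite mulrCA.
  apply: (@gen_min _ _ (Ideal HI)) => _ [f Kf <-] /=.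
  have [Qf QfE] := eval_taylor2 u x0 k f.
  have [-> _] := QfE y; have [z0 ->] := x0K f Kf.
  exists (t ^+ h * z0 + deval u x y f + k * eval idfun y Qf).
  by rewrite tmE; ring.
pose FF := ideal_mul F F.
have FFk z : ideal_set FF z -> ideal_set (ideal_scale k F) z.
  apply: gen_min => _ [v Fv [v' Fv' <-]].
  have [v1 ->] := Fk v Fv; exists (v1 * v'); first exact: idealM.
  by rewrite mulrA.
(* The identity [sE] is applied in C/F^2, where products of values of elements of [K] vanish. *)
have derF2 f : K f ->
    ideal_set FF (deval u x (fun j => eval u x (s j)) f - t ^+ h * eval u x f).
  move=> Kf; pose pi : {rmorphism C -> ring_quot FF} := quot_pi FF.
  apply/quot_pi_eq; rewrite -/(pi _) -/(pi (_ * _)).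
  rewrite rmorph_deval rmorphM rmorph_eval -rmorphXn -[pi (u _)]/((pi \o u) _).
  rewrite -sE //; last first.
    move=> f1 f2 K1 K2; rewrite -!rmorph_eval -rmorphM -(rmorph0 pi).
    apply/quot_pi_eq; rewrite subr0; apply: gen_mem.
    by exists (eval u x f1); [apply: FK|exists (eval u x f2) => //; apply: FK].
  by apply: eq_deval => // j; rewrite /= rmorph_eval.
(* The identity [sE] is applied at x + eps y over the dual numbers of C/F. There elements of [K]
   take values in the multiples of eps, and the coefficients of eps are compared. *)
have derF f : K f -> ideal_set F (deval u x (fun j => deval u x y (s j)) f -
    t ^+ h * deval u x y f).
  move=> Kf; pose pi : {rmorphism C -> ring_quot F} := quot_pi F.
  have pi0 f1 : K f1 -> eval (pi \o u) (pi \o x) f1 = 0.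
    move=> K1; rewrite -rmorph_eval -(rmorph0 pi).
    by apply/quot_pi_eq; rewrite subr0; apply: FK.
  pose D := sqzero (@idfun (ring_quot F)) ((ring_quot F)^o : lmodType _).
  pose v : {rmorphism A -> D} :=
    @sqzero_inl _ _ (@idfun (ring_quot F)) ((ring_quot F)^o) \o (pi \o u).
  have vE : v =1 (fun a => ((pi \o u) a, 0) : D) by [].
  pose X j : D := ((pi \o x) j, (pi \o y) j).
  have evX f1 : eval v X f1 = (eval (pi \o u) (pi \o x) f1,
      deval (pi \o u) (pi \o x) (pi \o y) f1) by rewrite -eval_dual.
  have sq0 f1 f2 : K f1 -> K f2 -> eval v X f1 * eval v X f2 = 0.
    move=> K1 K2; rewrite !evX !pi0 //; congr pair => /=; first exact: mulr0.
    by rewrite !scale0r addr0.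
  have := sE D v X sq0 f Kf.
  have -> : deval v X (fun j => eval v X (s j)) f = deval v X
      (fun j => (0, deval (pi \o u) (pi \o x) (pi \o y) (s j)) : D) f.
    by apply: eq_deval => // j; rewrite evX pi0.
  rewrite deval_dual evX => -[_]; rewrite scaler0 addr0.
  move=> E; apply/quot_pi_eq; rewrite -/(pi _) -/(pi (_ * _)).
  rewrite rmorphM !rmorph_deval -rmorphXn.
  rewrite -[RHS]E; apply: eq_deval => // j.
  by rewrite /= rmorph_deval.
have Fh z : ideal_set F z ->
    ideal_set (ideal_colon (t ^+ h) (ideal_scale k F)) z.
  apply: gen_min => _ [f Kf <-].
  suff: ideal_set (ideal_scale k F) (t ^+ h * eval u x f) by [].
  have -> : t ^+ h * eval u x f = k * deval u x w f -
      (deval u x (fun j => eval u x (s j)) f - t ^+ h * eval u x f).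
    rewrite -devalZ (eq_deval f (fun=> erefl) (fun=> erefl) sx).
    by rewrite opprB addrC addrNK.
  apply: idealD; last by apply: idealN; apply: FFk; apply: derF2.
  exists (deval u x w f) => //.
  rewrite /w (devalD u x _ (fun j => - (t ^+ h * y j))).
  rewrite (@eq_deval _ _ _ u u x x (fun j => - (t ^+ h * y j))
    (fun j => - t ^+ h * y j)) // ?devalZ ?mulNr; first exact: derF.
  by move=> j; rewrite mulNr.
(* From t^h z = k v and k = t^h t t^e, the element z - t t^e v is killed by t^h. It lies in k C,
   hence in t^r C, which has no t-torsion, so it is zero. Thus F = t F, and Nakayama's lemma
   applies. *)
have Ft z : ideal_set F z -> exists2 v, ideal_set F v & z = t * v.
  move=> Fz; have [v Fv vE] := Fh z Fz.
  exists (t ^+ e * v); first exact: idealM.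
  have [z' zE] := Fk z Fz; have [v' v'E] := Fk v Fv.
  have d0 : z - t * (t ^+ e * v) =
      t ^+ r * (t ^+ (m - h - r) * (z' - t * (t ^+ e * v'))).
    by rewrite zE v'E [RHS]mulrA -krE; ring.
  apply/eqP; rewrite -subr_eq0 d0; apply/eqP.
  apply: (torsion_exp tor (h := h)); rewrite -d0 mulrBr -vE kE.
  by rewrite !mulrA subrr.
have F0 z : ideal_set F z -> z = 0.
  have [l lF] := C_noeth F.
  have lFE z' : ideal_set F z' -> ideal_set (ideal_gen [set` l]) z'.
    by rewrite lF.
  have Fl z' : ideal_set (ideal_gen [set` l]) z' -> ideal_set F z'.
    by rewrite lF.
  pose zero_ideal := ideal_ker [the {rmorphism C -> C} of idfun].
  move=> /lFE; apply: (@gen_min _ _ zero_ideal).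
  apply: (@nakayama _ t) => // z' lz'.
  have [|v Fv ->] := Ft z'; first by apply: Fl; apply: gen_mem.
  exists v; last by rewrite subrr.
  by move/lFE: Fv; apply: gen_min => z2 ?; apply: gen_mem; right.
split=> [f Kf|I IK Itm j]; first by apply: F0; apply: FK.
(* Nakayama's lemma modulo the ideal of all z with t^m z in [I]: it contains [g0], as t^m g0 =
   s(x0), and y = -g0 - t t^e Q(y) with Q(y) in the ideal generated by the [y i]. *)
apply: Itm; suff: ideal_set (ideal_colon (t ^+ m) I) (y j) by [].
apply: (@nakayama _ t _ [seq y i | i <- enum 'I_n]) => //; last first.
  by apply/mapP; exists j; rewrite ?mem_enum.
move=> _ /mapP[i _ ->].
have [_ Qi] := QE i y.
exists (- (t ^+ e * eval idfun y (Q i))).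
  apply: idealN; apply: idealM; apply: Qi => i'; apply: gen_mem; right.
  by apply/mapP; exists i'; rewrite ?mem_enum.
have -> : y i - t * - (t ^+ e * eval idfun y (Q i)) = - g0 i.
  by apply/eqP; rewrite -subr_eq0 -(yE i) /=; apply/eqP; ring.
by apply: idealN; rewrite /= -g0E; apply: IK; apply: sK.
Qed.

End Newton.

(** * The approximation theorem *)

Lemma ideal_exp_gen1 (A : comPzRingType) (t : A) k x :
  ideal_set (ideal_exp (ideal_gen [set t]) k) x <-> exists z, x = t ^+ k * z.
Proof.
have Hpr (c : A) : is_ideal [set x | exists z, x = c * z].
  split=> [|_ _ [z1 ->] [z2 ->]|a _ [z ->]].
  - by exists 0; rewrite mulr0.
  - by exists (z1 + z2); rewrite mulrDr.
  - by exists (a * z); rewrite mulrCA.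
elim: k x => [|k IHk] x.
  split=> _; first by exists x; rewrite mul1r.
  exact: gen_mem.
split=> [|[z ->]].
  apply: (@gen_min _ _ (Ideal (Hpr _))) => _ [v tv [w /IHk[z ->] <-]].
  have [v' ->] : exists v', v = t * v'.
    apply: (@gen_min _ _ (Ideal (Hpr t)) _ _ tv) => _ ->.
    by exists 1; rewrite mulr1.
  by exists (v' * z); rewrite exprS; ring.
apply: gen_mem; exists t; first exact: gen_mem.
by exists (t ^+ k * z); [apply/IHk; exists z|rewrite exprS mulrA].
Qed.

Lemma ideal_ext_exp_gen1 (A : comPzRingType) (t : A) (C : algebra A) k x :
  ideal_set (ideal_ext C (ideal_exp (ideal_gen [set t]) k)) x <->
  exists z, x = alg_map C t ^+ k * z.
Proof.
split=> [|[z ->]].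
  have HI : is_ideal [set x | exists z, x = alg_map C t ^+ k * z].
    split=> [|_ _ [z1 ->] [z2 ->]|a _ [z ->]].
    - by exists 0; rewrite mulr0.
    - by exists (z1 + z2); rewrite mulrDr.
    - by exists (a * z); rewrite mulrCA.
  apply: (@gen_min _ _ (Ideal HI)) => _ [v /ideal_exp_gen1[z ->] <-].
  by exists (alg_map C z); rewrite rmorphM rmorphXn.
rewrite mulrC; apply: idealM; apply: gen_mem; exists (t ^+ k).
  by apply/ideal_exp_gen1; exists 1; rewrite mulr1.
by rewrite rmorphXn.
Qed.

(** The value at f(g) is f(x); this does not depend on [f], since two choices differ by a polynomial
    vanishing at [g]. *)
Lemma alg_hom_of_point (A : comPzRingType) (B C : algebra A) V (g : V -> B)
    (x : V -> C) :
  (forall b, exists s, eval (alg_map B) g s = b) ->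
  (forall f, vanishing g f -> eval (alg_map C) x f = 0) ->
  exists al : alg_hom B C,
    forall f, al (eval (alg_map B) g f) = eval (alg_map C) x f.
Proof.
move=> /choice[s sE] xK; pose al b := eval (alg_map C) x (s b).
have alE f : al (eval (alg_map B) g f) = eval (alg_map C) x f.
  apply/eqP; rewrite -subr_eq0 -mulN1r -(rmorphN1 (alg_map C)).
  rewrite -[_ + _]/(eval _ x (Add _ (Mul (Cst (- 1)) f))) xK //.
  by rewrite /vanishing /= rmorphN1 mulN1r sE subrr.
have al_sub : zmod_morphism al.
  move=> b c; rewrite -{1}[b]sE -{1}[c]sE -mulN1r -(rmorphN1 (alg_map B)).
  rewrite -[_ + _]/(eval _ g (Add _ (Mul (Cst (- 1)) _))) alE /=.
  by rewrite rmorphN1 mulN1r.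
have al_monoid : monoid_morphism al.
  split=> [|b c].
    by rewrite -(rmorph1 (alg_map B)) (alE (Cst 1)) /= rmorph1.
  by rewrite -{1}[b]sE -{1}[c]sE -[_ * _]/(eval _ g (Mul _ _)) alE.
pose al_add := GRing.isZmodMorphism.Build B C al al_sub.
pose al_mul := GRing.isMonoidMorphism.Build B C al al_monoid.
pose alM : {rmorphism B -> C} := HB.pack al al_add al_mul.
have alA a : alM (alg_map B a) = alg_map C a by apply: (alE (Cst a)).
by exists (AlgHom alA).
Qed.

Lemma quot_eval_congr (A : Type) (C : comPzRingType) V (u : A -> C)
    (x x' : V -> C) (J : ideal C) (f : term A V) :
  (forall j, ideal_set J (x j - x' j)) ->
  quot_pi J (eval u x f) = quot_pi J (eval u x' f).
Proof.
move=> xx'; pose pi : {rmorphism C -> ring_quot J} := quot_pi J.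
rewrite -!/(pi _) !rmorph_eval; apply: eq_eval => // j.
exact/quot_pi_eq/xx'.
Qed.

Lemma quot_eval_lift (A : comPzRingType) (B C : algebra A) V (g : V -> B)
    (J : ideal C) (al : alg_hom B (quot_alg J)) (x : V -> C) f :
  (forall j, quot_pi J (x j) = al (g j)) ->
  quot_pi J (eval (alg_map C) x f) = al (eval (alg_map B) g f).
Proof.
move=> xg; pose pi : {rmorphism C -> ring_quot J} := quot_pi J.
rewrite -/(pi _) !rmorph_eval; apply: eq_eval => a; last exact: xg.
by rewrite /= alg_homP.
Qed.

Theorem theorem32 (A : comPzRingType) (t : A) (a : ideal A)
  (B B' C C' : algebra A) (phi : alg_hom B B') (psi : alg_hom C C')
  (I : ideal C) (n r h c : nat)
  (alphan : alg_hom B (quot_alg (ideal_ext C (ideal_exp a n))))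
  (betan : alg_hom B' (quot_alg (ideal_ext C' (ideal_exp a n)))) :
  noetherian A -> noetherian B -> noetherian B' ->
  noetherian C -> noetherian C' ->
  a = ideal_gen [set t] ->
  (forall y, exists x, phi x = y) ->
  (forall y, exists x, psi x = y) ->
  finitely_generated B -> finitely_generated B' ->
  henselian (ideal_ext C a) -> henselian (ideal_ext C' a) ->
  I = ideal_ker psi ->
  ideal_ext C (ideal_exp a r) `&` [set x | alg_map C t * x = 0] = [set 0] ->
  ideal_ext C' (ideal_exp a r) `&` [set x | alg_map C' t * x = 0] = [set 0] ->
  (forall k, (c <= k)%N ->
    ideal_cap (ideal_ext C (ideal_exp a k)) I =
    ideal_mul (ideal_ext C (ideal_exp a (k - c)))
      (ideal_cap (ideal_ext C (ideal_exp a c)) I) :> set C) ->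
  ideal_ext B (ideal_exp a h) `<=` H_alg B ->
  ideal_ext B' (ideal_exp a h) `<=` H_alg B' ->
  (maxn (r + 2 * h) (maxn (c + 2 * h) (4 * h)) < n)%N ->
  (forall b, quot_map psi (ideal_ext C' (ideal_exp a n)) (alphan b) =
             betan (phi b)) ->
  exists (alpha : alg_hom B C) (beta : alg_hom B' C'),
    [/\ forall b, psi (alpha b) = beta (phi b),
        forall b, quot_pi (ideal_ext C (ideal_exp a (n - 2 * h))) (alpha b) =
          quot_map idfun (ideal_ext C (ideal_exp a (n - 2 * h))) (alphan b)
      & forall b, quot_pi (ideal_ext C' (ideal_exp a (n - 2 * h))) (beta b) =
          quot_map idfun (ideal_ext C' (ideal_exp a (n - 2 * h))) (betan b)].
Proof.
move=> _ _ _ noethC noethC' aE _ psi_surj fgB fgB' hensC hensC' -> torC torC' _.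
move=> HB HB' nlarge compat; subst a.
pose J (E : algebra A) k := ideal_ext E (ideal_exp (ideal_gen [set t]) k).
have JP (E : algebra A) k x :
    ideal_set (J E k) x <-> exists z, x = alg_map E t ^+ k * z.
  exact: ideal_ext_exp_gen1.
have JE (E : algebra A) k z : ideal_set (J E k) (alg_map E t ^+ k * z).
  by apply/JP; exists z.
have Jle (E : algebra A) k l x :
    (l <= k)%N -> ideal_set (J E k) x -> ideal_set (J E l) x.
  move=> lk /JP[z ->]; apply/JP; exists (alg_map E t ^+ (k - l) * z).
  by rewrite mulrA -exprD subnKC.
have tJ (E : algebra A) :
    ideal_set (ideal_ext E (ideal_gen [set t])) (alg_map E t).
  by apply: gen_mem; exists t => //; apply: gen_mem.
have tor (E : algebra A) :
    J E r `&` [set x | alg_map E t * x = 0] = [set 0] -> forall z,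
    alg_map E t * (alg_map E t ^+ r * z) = 0 -> alg_map E t ^+ r * z = 0.
  move=> torE z tz; suff : [set (0 : E)] (alg_map E t ^+ r * z) by [].
  by rewrite -torE; split.
have Hh (E : algebra A) : J E h `<=` H_alg E -> H_alg E (alg_map E (t ^+ h)).
  by apply; rewrite rmorphXn -[_ ^+ _]mulr1; apply: JE.
have [ng [g g_gen]] := generated_by_terms fgB.
have [ng' [g' g'_gen]] := generated_by_terms fgB'.
(* An arbitrary lift of [betan]; the relations of [B'] hold at it modulo t^n, so [newton] applies
   with m = n and moves it by a multiple of t^(n - h). *)
pose y0 j := repr (betan (g' j)).
have y0E f : quot_pi (J C' n) (eval (alg_map C') y0 f) =
    betan (eval (alg_map B') g' f).
  by apply: quot_eval_lift => j; apply: quot_pi_repr.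
have y0K f : vanishing g' f ->
    exists z, eval (alg_map C') y0 f = alg_map C' t ^+ n * z.
  move=> f0; apply/JP; rewrite -[eval _ _ _]subr0; apply/quot_pi_eq.
  by rewrite y0E f0 !rmorph0.
have [||y' [y'K _]] := @newton A B' C' ng' g' g'_gen t h n r _ (Hh _ HB')
  noethC' hensC' (tJ C') (tor C' torC') _ _ y0 y0K.
  1,2: by lia.
have [beta betaE] := alg_hom_of_point g'_gen y'K.
have beta_approx k : (k <= n - h)%N -> forall b,
    quot_pi (J C' k) (beta b) = quot_map idfun (J C' k) (betan b).
  move=> kn b; have [f <-] := g'_gen b; rewrite betaE -y0E.
  rewrite (quot_mapE (f := [the {rmorphism C' -> C'} of idfun])); last first.
    by move=> y; apply: Jle; lia.
  apply: quot_eval_congr => j; rewrite addrC addKr.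
  exact: (Jle _ _ _ _ kn (JE _ _ _)).
pose x1 j := repr (alphan (g j)).
have psit : psi (alg_map C t) = alg_map C' t by apply: alg_homP.
(* [beta] agrees with [betan] only modulo t^(n - h), so the lift [x1] of [alphan] is changed by a
   multiple of t^(n - h), found by surjectivity of [psi], to lie exactly over [beta] after [phi]. *)
have /choice[e eE] j :
    exists e, psi (x1 j + alg_map C t ^+ (n - h) * e) = beta (phi (g j)).
  have : quot_pi (J C' (n - h)%N) (beta (phi (g j))) =
         quot_pi (J C' (n - h)%N) (psi (x1 j)).
    rewrite beta_approx // -compat /quot_map /=; apply/quot_pi_eq.
    apply: (Jle _ n); first by lia.
    exact/quot_pi_eq/quot_pi_repr.
  move=> /quot_pi_eq/JP[z zE]; have [e eE] := psi_surj z.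
  by exists e; rewrite rmorphD rmorphM rmorphXn psit eE -zE addrC subrK.
pose x0 j := x1 j + alg_map C t ^+ (n - h) * e j.
have psi_eval x f : psi (eval (alg_map C) x f) = eval (alg_map C') (psi \o x) f.
  by rewrite rmorph_eval; apply: eq_eval => // d; apply: alg_homP.
have psix0 f : psi (eval (alg_map C) x0 f) = beta (phi (eval (alg_map B) g f)).
  rewrite !rmorph_eval; apply: eq_eval => [d|j] /=; last exact: eE.
  by rewrite !alg_homP.
have x1E f : quot_pi (J C n) (eval (alg_map C) x1 f) =
    alphan (eval (alg_map B) g f).
  by apply: quot_eval_lift => j; apply: quot_pi_repr.
have x0K f : vanishing g f ->
    exists z, eval (alg_map C) x0 f = alg_map C t ^+ (n - h) * z.
  move=> f0; apply/JP; rewrite -[eval _ _ _](addrNK (eval (alg_map C) x1 f)).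
  apply: idealD.
    apply/quot_pi_eq/quot_eval_congr => j.
    by rewrite addrC addKr; apply: JE.
  apply: (Jle _ n); first by lia.
  rewrite -[eval _ _ _]subr0; apply/quot_pi_eq.
  by rewrite x1E f0 !rmorph0.
(* Now m = n - h, and the point moves by a multiple of t^(n - 2h). *)
have [||x' [x'K x'I]] := @newton A B C ng g g_gen t h (n - h) r _ (Hh _ HB)
  noethC hensC (tJ C) (tor C torC) _ _ x0 x0K.
  1,2: by lia.
have [alpha alphaE] := alg_hom_of_point g_gen x'K.
(* The correction stays in ker psi: the relations at [x0] lie there, and if [psi] kills t^(n - h) z,
   then t^h kills t^(n - 2h) psi(z), which lies in t^r C' and is therefore zero. *)
have psix' j : psi (alg_map C t ^+ (n - h - h) * x' j) = 0.
  apply: (x'I (ideal_ker psi)) => [f f0|z /=].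
    by rewrite /= psix0 f0 !rmorph0.
  rewrite !rmorphM !rmorphXn !psit => tz.
  have rE : alg_map C' t ^+ (n - h - h) =
      alg_map C' t ^+ r * alg_map C' t ^+ (n - h - h - r).
    by rewrite -exprD; congr (_ ^+ _); lia.
  rewrite rE -mulrA; apply: (torsion_exp (tor C' torC') (h := h)).
  rewrite mulrA mulrA -(mulrA (_ ^+ h)) -rE -exprD -tz; congr (_ ^+ _ * _).
  by lia.
exists alpha, beta; split=> [b|b|b].
- have [f <-] := g_gen b; rewrite alphaE -psix0 !psi_eval.
  by apply: eq_eval => // j; rewrite /= rmorphD psix' addr0.
- have [f <-] := g_gen b; rewrite alphaE -x1E.
  rewrite (quot_mapE (f := [the {rmorphism C -> C} of idfun])); last first.
    by move=> y; apply: Jle; lia.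
  apply: quot_eval_congr => j.
  (* The final point differs from [x1] by t^(n - h) e from the adjustment over [beta] and by t^(n -
     2h) x' from [newton]. *)
  rewrite addrC /x0 -addrA addKr; apply: idealD.
    by apply: (Jle _ (n - h)%N _ _ _ (JE _ _ _)); lia.
  by apply: (Jle _ (n - h - h)%N _ _ _ (JE _ _ _)); lia.
- by apply: beta_approx; lia.
Qed.
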